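(* Let $n\geq 2$ be an integer and let $\alpha$ be a unital $*$-endomorphism of the Cuntz algebra $\mathcal{O}_n$. Then $\alpha$ is modestly scaling if one of the following conditions holds: (i) $\alpha$ is an automorphism of $\mathcal{O}_n$; (ii) $\alpha(\mathcal{F}_n)\subseteq\mathcal{F}_n$.
   Context: The Cuntz algebra $\mathcal{O}_n$ is the $C^*$-algebra generated by $n$ isometries $S_1,\ldots,S_n$ with $\sum_{i=1}^nS_iS_i^*=1$. $W_n$ is the set of all finite words (multi-indices, including the empty word $\emptyset$) in the alphabet $\{1,\ldots,n\}$, and $W_n^k$ is the set of words of length $k$. For $\mu=\mu_1\ldots\mu_k\in W_n$ put $S_\mu=S_{\mu_1}\cdots S_{\mu_k}$, $S_\emptyset=1$, and $P_\mu=S_\mu S_\mu^*$. The core UHF-subalgebra $\mathcal{F}_n\subseteq\mathcal{O}_n$ is the norm closure of $\bigcup_{k\geq 0}\mathcal{F}_n^k$, where $\mathcal{F}_n^k$ is the linear span of all $S_\mu S_\nu^*$ with $\mu,\nu\in W_n^k$. A unital $*$-endomorphism $\alpha$ of $\mathcal{O}_n$ is called modestly scaling if for every sequence $(\nu_k)_{k\geq1}$ of non-empty multi-indices in $W_n$, whenever $p\in\mathcal{O}_n$ is a projection with $p\leq\alpha(P_{\nu_1\ldots\nu_k})$ for all $k\in\mathbb{N}$ (where $\nu_1\ldots\nu_k$ denotes concatenation), then $p=0$. *)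

(* Defs.v *)
From HB Require Import structures.
From mathcomp Require Import all_boot all_order all_algebra.
From mathcomp Require Import complex.
From mathcomp Require Import boolp classical_sets reals topology normedtype.
Import numFieldNormedType.Exports.
Set Implicit Arguments.
Unset Strict Implicit.
Unset Printing Implicit Defensive.
Import Order.TTheory GRing.Theory Num.Theory.
Local Open Scope classical_set_scope.
Local Open Scope ring_scope.
Local Open Scope complex_scope.

(* Unital C*-algebras over the complex numbers R[i].  This is a plain record
   and not an HB structure because the join of the algebra and normed-module
   hierarchies would have to be declared below numDomainType.  The HB instances
   declared after the record on [cstar_sort A] restore both hierarchies.
   The norm takes its values in R[i], as for every normedModType R[i]. *)
Record cstarAlgebra (R : realType) := CStarAlgebra {
  cstar_carrier : completeNormedModType R[i];
  cstar_one : cstar_carrier;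
  cstar_mul : cstar_carrier -> cstar_carrier -> cstar_carrier;
  cstar_star : cstar_carrier -> cstar_carrier;
  cstar_mulA : associative cstar_mul;
  cstar_mul1 : left_id cstar_one cstar_mul;
  cstar_mulr1 : right_id cstar_one cstar_mul;
  cstar_mulDl : left_distributive cstar_mul +%R;
  cstar_mulDr : right_distributive cstar_mul +%R;
  cstar_one_neq0 : cstar_one != 0;
  cstar_scaleAl : forall (c : R[i]) x y,
    c *: cstar_mul x y = cstar_mul (c *: x) y;
  cstar_scaleAr : forall (c : R[i]) x y,
    c *: cstar_mul x y = cstar_mul x (c *: y);
  cstar_starK : involutive cstar_star;
  cstar_starD : {morph cstar_star : x y / x + y};
  cstar_starZ : forall (c : R[i]) x, cstar_star (c *: x) = c^* *: cstar_star x;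
  cstar_starM : forall x y,
    cstar_star (cstar_mul x y) = cstar_mul (cstar_star y) (cstar_star x);
  cstar_normM : forall x y, `|cstar_mul x y| <= `|x| * `|y|;
  cstar_normC : forall x, `|cstar_mul (cstar_star x) x| = `|x| ^+ 2 }.

Definition cstar_sort (R : realType) (A : cstarAlgebra R) : Type :=
  cstar_carrier A.
Coercion cstar_sort : cstarAlgebra >-> Sortclass.

HB.instance Definition _ (R : realType) (A : cstarAlgebra R) :=
  CompleteNormedModule.copy (cstar_sort A) (cstar_carrier A).
HB.instance Definition _ (R : realType) (A : cstarAlgebra R) :=
  GRing.Zmodule_isNzRing.Build (cstar_sort A) (@cstar_mulA R A)
    (@cstar_mul1 R A) (@cstar_mulr1 R A) (@cstar_mulDl R A) (@cstar_mulDr R A)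
    (@cstar_one_neq0 R A).
HB.instance Definition _ (R : realType) (A : cstarAlgebra R) :=
  GRing.Lmodule_isLalgebra.Build R[i] (cstar_sort A) (@cstar_scaleAl R A).
HB.instance Definition _ (R : realType) (A : cstarAlgebra R) :=
  GRing.Lalgebra_isAlgebra.Build R[i] (cstar_sort A) (@cstar_scaleAr R A).

Definition star (R : realType) (A : cstarAlgebra R) (x : A) : A :=
  @cstar_star R A x.

Section CStar.
Context {R : realType} {A : cstarAlgebra R}.
Implicit Types (x y a b p : A) (B G : set A).

Definition star_subalgebra B : Prop :=
  [/\ B 0,
      (forall x y, B x -> B y -> B (x + y)),
      (forall (c : R[i]) x, B x -> B (c *: x)),
      (forall x y, B x -> B y -> B (x * y)) &
      (forall x, B x -> B (star x))].

(* The C*-subalgebra generated by G. *)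
Definition cstar_generated G : set A :=
  [set x : A | forall B, closed B -> star_subalgebra B -> G `<=` B -> B x].

Definition isometry x : Prop := star x * x = 1.

Definition projection p : Prop := p * p = p /\ star p = p.

(* a <= b when b - a is positive, that is, of the form x^* x. *)
Definition cstar_le a b : Prop := exists x, b - a = star x * x.

(* A is the Cuntz algebra O_n, with canonical generators S. *)
Definition is_cuntz_algebra n (S : 'I_n -> A) : Prop :=
  [/\ forall i, isometry (S i),
      \sum_(i < n) S i * star (S i) = 1 &
      cstar_generated (range S) = setT].

Definition word_op n (S : 'I_n -> A) (mu : seq 'I_n) : A :=
  \prod_(i <- mu) S i.

Definition word_proj n (S : 'I_n -> A) (mu : seq 'I_n) : A :=
  word_op S mu * star (word_op S mu).

Definition core_level n (S : 'I_n -> A) (k : nat) : set A :=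
  [set x : A | exists c : k.-tuple 'I_n -> k.-tuple 'I_n -> R[i],
     x = \sum_mu \sum_nu c mu nu *: (word_op S mu * star (word_op S nu))].

Definition core_UHF n (S : 'I_n -> A) : set A :=
  closure (\bigcup_k core_level S k).

(* nu is indexed from 0, so nu_1 ... nu_(k+1) is flatten (mkseq nu k.+1). *)
Definition modestly_scaling n (S : 'I_n -> A) (alpha : A -> A) : Prop :=
  forall nu : nat -> seq 'I_n, (forall k, nu k <> [::]) ->
  forall p, projection p ->
    (forall k, cstar_le p (alpha (word_proj S (flatten (mkseq nu k.+1))))) ->
    p = 0.

End CStar.

(* Main.v *)
From HB Require Import structures.
From mathcomp Require Import all_boot all_order all_algebra.
From mathcomp Require Import complex ring lra zify.
From mathcomp Require Import boolp classical_sets reals topology normedtype.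
Require Import Defs.
Import numFieldNormedType.Exports.
Set Implicit Arguments.
Unset Strict Implicit.
Unset Printing Implicit Defensive.
Import Order.TTheory GRing.Theory Num.Theory.
Local Open Scope classical_set_scope.
Local Open Scope ring_scope.
Local Open Scope complex_scope.

(** Consider the averaging map [T x = n^-1 sum_i S_i^* x S_i]. For every [x] the
iterates [T^M x] converge in norm to a scalar multiple [phi x] of the unit
([state_at_exists]). On a monomial [S_mu S_nu^*] this is visible: [T] strips equal
first letters, annihilates different ones, and once one of the two words is
exhausted each step gains a factor [1 / n]. The functional [phi] is the trace of
the core composed with the expectation onto the core; the limit gives both at once.

From its definition [phi] inherits invariance under [T] and the relation
[phi (S_mu x) = n^-|mu| phi (x S_mu)] ([phi_shift]). Hence
[phi P_mu = n^-|mu|], and [phi (f x) = phi (x f)] for [f] in the core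
([phi_core_comm]). If [alpha] maps the core to itself, then the projections
[alpha P_mu] with [|mu| = k] sum to 1 and are equivalent through elements of the
core, so [phi (alpha P_mu) = n^-|mu|] as well ([phi_endo_word_proj]). A projection
below [alpha P_mu] for words of unbounded length thus has [phi p = 0], as [phi] is
positive ([phi_ge0]). If [alpha] is an automorphism, the preimage of [p] is below
the projections [P_mu], and the same argument applies with the identity in place
of [alpha].

It remains that [phi] is faithful ([phi_faithful]). The usual proof integrates over
the gauge action, whose existence is a consequence of the uniqueness of the
Cuntz algebra. Here the Fejer means of that action are obtained as compressions by
isometries of the algebra. Let [V] be the isometry of a word without small
periods and [t_i] the image of [V] under [L + i] iterations of the shift
endomorphism [x |-> sum_j S_j x S_j^*]. The [t_i] are isometries with orthogonal
ranges, and [t_i^* v t_j] is [v] if the monomial [v] has gauge degree [i - j], and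
0 otherwise. Thus compressing by [L^-1/2 sum_(i < L) t_i] multiplies [v] by
[1 - |d| / L], where [d] is its degree, and these contractions tend to the
identity pointwise ([fejer_cvg]). Further averages of the same kind do not change
this but turn the image of [x^* x] into a combination of monomials whose
coefficients are values of [phi] at elements [(x S_mu)^* (x S_nu)]
([fejer_vanishing]); by the Cauchy-Schwarz inequality they vanish if
[phi (x^* x) = 0], and then [x = 0]. *)

(** * Real-valued norms and approximation *)
Section Norm.
Context {R : realType}.

(** The norms take their values in [R[i]], with its partial order; the real part
brings them into the totally ordered field [R]. *)
Definition nrm (V : normedZmodType R[i]) (x : V) : R := complex.Re `|x|.

Lemma nrmE (V : normedZmodType R[i]) (x : V) : `|x| = (nrm x)%:C.
Proof. by rewrite /nrm RRe_real // ger0_real // normr_ge0. Qed.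

Lemma nrm_ge0 (V : normedZmodType R[i]) (x : V) : 0 <= nrm x.
Proof. by rewrite -lecR -nrmE normr_ge0. Qed.

Lemma nrm0 (V : normedZmodType R[i]) : nrm (0 : V) = 0.
Proof. by rewrite /nrm normr0. Qed.

Lemma nrm0_eq (V : normedZmodType R[i]) (x : V) : nrm x = 0 -> x = 0.
Proof. by move=> h; apply/eqP; rewrite -normr_eq0 nrmE h. Qed.

Lemma nrmN (V : normedZmodType R[i]) (x : V) : nrm (- x) = nrm x.
Proof. by rewrite /nrm normrN. Qed.

Lemma nrmB (V : normedZmodType R[i]) (x y : V) : nrm (x - y) = nrm (y - x).
Proof. by rewrite /nrm distrC. Qed.

Lemma nrm_leD (V : normedZmodType R[i]) (x y : V) :
  nrm (x + y) <= nrm x + nrm y.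
Proof. by rewrite -lecR rmorphD /= -!nrmE ler_normD. Qed.

Lemma nrm_tri (V : normedZmodType R[i]) (z x y : V) :
  nrm (x - y) <= nrm (x - z) + nrm (z - y).
Proof. by apply: le_trans (nrm_leD _ _); rewrite addrA subrK. Qed.

Lemma nrm_sum (V : normedZmodType R[i]) I (r : seq I) (F : I -> V) :
  nrm (\sum_(i <- r) F i) <= \sum_(i <- r) nrm (F i).
Proof.
elim/big_ind2 : _ => //; first by rewrite nrm0.
by move=> x a y b hx hy; apply: le_trans (nrm_leD _ _) (lerD hx hy).
Qed.

Lemma nrm_eq0 (V : normedZmodType R[i]) (x : V) :
  (forall e : R, 0 < e -> nrm x <= e) -> x = 0.
Proof.
move=> h; apply: nrm0_eq; apply/eqP; rewrite eq_le nrm_ge0 andbT.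
by apply/ler_addgt0Pr => e e0; rewrite add0r h.
Qed.

Lemma nrmC (c : R[i]) : (nrm c) ^+ 2 = complex.Re c ^+ 2 + complex.Im c ^+ 2.
Proof.
by rewrite /nrm normc_def /= sqr_sqrtr // addr_ge0 // sqr_ge0.
Qed.

Lemma nrmC_Re (c : R[i]) : `|complex.Re c| <= nrm c.
Proof. by rewrite -lecR -nrmE normc_ge_Re. Qed.

Lemma nrmC_ReIm (c : R[i]) : nrm c <= `|complex.Re c| + `|complex.Im c|.
Proof.
rewrite -(ler_pXn2r (n := 2)) ?nnegrE ?nrm_ge0 ?addr_ge0 //.
rewrite nrmC -(real_normK (num_real (complex.Re c))).
rewrite -(real_normK (num_real (complex.Im c))).
have := normr_ge0 (complex.Re c); have := normr_ge0 (complex.Im c).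
by nra.
Qed.

Lemma nrmC_Im (c : R[i]) : `|complex.Im c| <= nrm c.
Proof.
rewrite -(ler_pXn2r (n := 2)) ?nnegrE ?nrm_ge0 //.
by rewrite nrmC real_normK ?num_real // lerDr sqr_ge0.
Qed.

Lemma nrmC_real (c : R) : nrm (c%:C) = `|c|.
Proof. by rewrite /nrm normc_def /= expr0n addr0 sqrtr_sqr. Qed.

Lemma nrmZ (V : normedModType R[i]) (c : R[i]) (x : V) :
  nrm (c *: x) = nrm c * nrm x.
Proof. by apply: complexI; rewrite rmorphM /= -!nrmE normrZ. Qed.

Lemma closure_approx (V : normedModType R[i]) (B : set V) x :
  closure B x -> forall e : R, 0 < e -> exists2 y, B y & nrm (x - y) < e.
Proof.
move=> cx e e0; have e0' : 0 < e%:C :> R[i] by rewrite ltcR.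
have [y [By]] := cx _ (nbhsx_ballx x _ e0').
by rewrite -ball_normE /= nrmE ltcR; exists y.
Qed.

Lemma closed_approx (V : normedModType R[i]) (B : set V) :
  (forall x, (forall e : R, 0 < e -> exists2 y, B y & nrm (x - y) < e) -> B x) ->
  closed B.
Proof. by move=> h x /closure_approx; exact: h. Qed.

(** Completeness of the line for approximations that carry their own error
bounds: the limit is the least upper bound of the lower ends [f e - e]. *)
Lemma real_limit (f : R -> R) :
  (forall e d, 0 < e -> 0 < d -> `|f e - f d| <= e + d) ->
  exists c, forall e, 0 < e -> `|f e - c| <= e.
Proof.
move=> h; pose E := [set f e - e | e in [set e : R | 0 < e]].
have E0 : E !=set0 by exists (f 1 - 1); exists 1 => //=; exact: ltr01.
have ubE d : 0 < d -> ubound E (f d + d).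
  move=> d0 _ [e /= e0 <-]; have := h e d e0 d0; rewrite ler_norml.
  by move=> /andP[]; lra.
exists (sup E) => e e0; rewrite ler_norml; apply/andP; split.
  have : sup E <= f e + e by apply: ge_sup => //; exact: ubE.
  by lra.
have : f e - e <= sup E.
  by apply: ub_le_sup; [exists (f 1 + 1); exact: ubE|exists e].
by lra.
Qed.

Lemma complex_limit (f : R -> R[i]) :
  (forall e d, 0 < e -> 0 < d -> nrm (f e - f d) <= e + d) ->
  exists c, forall e, 0 < e -> nrm (f e - c) <= e + e.
Proof.
move=> h.
have [|a ha] := @real_limit (fun e => complex.Re (f e)).
  move=> e d e0 d0; apply: le_trans (h e d e0 d0).
  by rewrite -raddfB; exact: nrmC_Re.
have [|b hb] := @real_limit (fun e => complex.Im (f e)).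
  move=> e d e0 d0; apply: le_trans (h e d e0 d0).
  by rewrite -raddfB; exact: nrmC_Im.
exists (a +i* b) => e e0; apply: le_trans (nrmC_ReIm _) _.
by rewrite !raddfB; exact: lerD (ha _ e0) (hb _ e0).
Qed.

End Norm.

(** * Norm and involution of a C*-algebra *)
Section Star.
Context {R : realType} {A : cstarAlgebra R}.
Implicit Types x y : A.

Lemma starK x : star (star x) = x.
Proof. exact: cstar_starK. Qed.

Lemma starD x y : star (x + y) = star x + star y.
Proof. exact: cstar_starD. Qed.

Lemma starM x y : star (x * y) = star y * star x.
Proof. exact: cstar_starM. Qed.

Lemma starZ (c : R[i]) x : star (c *: x) = conjc c *: star x.
Proof. exact: cstar_starZ. Qed.

Lemma star0 : star 0 = 0 :> A.
Proof. by apply: (addrI (star 0)); rewrite -starD !addr0. Qed.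

Lemma starN x : star (- x) = - star x.
Proof. by apply: (addrI (star x)); rewrite -starD !subrr star0. Qed.

Lemma starB x y : star (x - y) = star x - star y.
Proof. by rewrite starD starN. Qed.

Lemma star1 : star 1 = 1 :> A.
Proof. by rewrite -[LHS]mul1r -[X in X * _]starK -starM mul1r starK. Qed.

Lemma star_sum I (r : seq I) (F : I -> A) :
  star (\sum_(i <- r) F i) = \sum_(i <- r) star (F i).
Proof. by apply: (big_morph _ starD star0). Qed.

Lemma nrmM x y : nrm (x * y) <= nrm x * nrm y.
Proof. by rewrite -lecR rmorphM /= -!nrmE; exact: cstar_normM. Qed.

Lemma nrm_starM x : nrm (star x * x) = nrm x ^+ 2.
Proof. by apply: complexI; rewrite rmorphXn /= -!nrmE; exact: cstar_normC. Qed.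

Lemma nrm1 : nrm (1 : A) = 1.
Proof.
have := nrm_starM 1; rewrite star1 mulr1 => /eqP.
rewrite -subr_eq0 -[X in X - _]mulr1 expr2 -mulrBr mulf_eq0 => /orP[/eqP/nrm0_eq/eqP|].
  by rewrite oner_eq0.
by rewrite subr_eq0 => /eqP.
Qed.

(** Half of the isometry of the involution, obtained by dividing
[nrm x ^+ 2 = nrm (star x * x)] by [nrm x]. *)
Lemma nrm_star_le x : nrm x <= nrm (star x).
Proof.
have [->|x0] := eqVneq (nrm x) 0; first exact: nrm_ge0.
rewrite -(ler_pM2r (x := nrm x)) ?lt_def ?x0 ?nrm_ge0 // -expr2 -nrm_starM.
exact: nrmM.
Qed.

Lemma nrm_star x : nrm (star x) = nrm x.
Proof.
by apply/eqP; rewrite eq_le nrm_star_le andbT -{2}(starK x) nrm_star_le.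
Qed.

Lemma nrm_isometry x : isometry x -> nrm x = 1.
Proof.
move=> hx; have := nrm_starM x; rewrite hx nrm1 => /esym/eqP.
by rewrite sqrf_eq1 => /orP[/eqP//|/eqP h]; have := nrm_ge0 x; rewrite h; lra.
Qed.

(** The only source of norm estimates: all the maps used below are averages of
such compressions. *)
Lemma nrm_compress x y z : isometry y -> isometry z ->
  nrm (star y * x * z) <= nrm x.
Proof.
move=> hy hz; apply: le_trans (nrmM _ _) _.
rewrite (nrm_isometry hz) mulr1; apply: le_trans (nrmM _ _) _.
by rewrite nrm_star (nrm_isometry hy) mul1r.
Qed.

Lemma isometryM x y : isometry x -> isometry y -> isometry (x * y).
Proof.
rewrite /isometry => hx hy.
by rewrite starM mulrA -(mulrA (star y)) hx mulr1.
Qed.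

Lemma isometry1 : isometry (1 : A).
Proof. by rewrite /isometry star1 mul1r. Qed.

End Star.

(** * The unit is an extreme point of the unit ball *)
Section Extreme.
Context {R : realType} {A : cstarAlgebra R}.
Implicit Types x y : A.

Lemma nrmC_nat m : nrm (m%:R : R[i]) = m%:R.
Proof. by rewrite -(rmorph_nat (real_complex R)) nrmC_real normr_nat. Qed.

Lemma nrmC_natV m : nrm ((m%:R)^-1 : R[i]) = (m%:R)^-1.
Proof.
by rewrite -(rmorph_nat (real_complex R)) -fmorphV nrmC_real ger0_norm
  ?invr_ge0 ?ler0n.
Qed.

Lemma mulC_ii : 'i * 'i = -1 :> R[i].
Proof. by rewrite -expr2 sqr_i. Qed.

Lemma double_rotate x :
  2%:R *: (1 + (1 + 'i : R[i]) *: x) = (1 + x) * (1 + x) +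
    (1 + ('i : R[i]) *: x) * (1 + ('i : R[i]) *: x).
Proof.
rewrite !mulrDl !mulrDr !mul1r !mulr1 -!scalerAl -!scalerAr !scalerA mulC_ii.
rewrite scaleN1r scaler_nat mulr2n scalerDl scale1r.
rewrite [RHS]addrACA [X in _ = _ + X]addrACA subrr addr0.
by rewrite [X in _ = X + _]addrACA [LHS]addrACA addrA.
Qed.

(** By the previous identity [1 + (1 + i) x] is the mean of [(1 + x)^2] and
[(1 + i x)^2]. *)
Lemma ball_rotate x :
  nrm (1 + x) <= 1 -> nrm (1 + ('i : R[i]) *: x) <= 1 ->
  nrm (1 + (1 + 'i : R[i]) *: x) <= 1.
Proof.
move=> h1 h2; have : nrm (2%:R *: (1 + (1 + 'i : R[i]) *: x)) <= 2.
  rewrite double_rotate; apply: le_trans (nrm_leD _ _) _.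
  rewrite -[2]/(1 + 1) lerD // ; apply: le_trans (nrmM _ _) _;
  by rewrite -[X in _ <= X]mulr1 ler_pM ?nrm_ge0.
by rewrite nrmZ nrmC_nat; lra.
Qed.

(** The set [good] of all [y] such that [1 + i^k y] lies in the unit ball for every
[k] is stable under multiplication by [1 + i], hence by [2]; being bounded, it
is reduced to 0. Self-adjointness puts [x] in it: for [c = i] or [c = - i],
[(1 + c x)^* (1 + c x) = 1 + x^2] is the mean of [(1 + x)^2] and [(1 - x)^2].

This replaces the order theory of C*-algebras in the one place where several
positive elements with zero sum have to vanish. *)
Lemma one_extreme x : star x = x -> nrm (1 + x) <= 1 -> nrm (1 - x) <= 1 ->
  x = 0.
Proof.
move=> sx h1 hN1.
pose good y := forall k, nrm (1 + ('i : R[i]) ^+ k *: y) <= 1.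
have g0 : good x.
  have hi (c : R[i]) : conjc c = - c -> c * c = -1 -> nrm (1 + c *: x) <= 1.
    move=> cc c2; have : nrm (1 + c *: x) ^+ 2 <= 1.
      rewrite -nrm_starM starD star1 starZ sx cc.
      rewrite mulrDl mul1r mulrDr mulr1 -scalerAl -scalerAr scalerA mulNr c2.
      rewrite opprK scale1r scaleNr addrA addrK.
      have -> : 1 + x * x = 2^-1 *: ((1 + x) * (1 + x) + (1 - x) * (1 - x)).
        rewrite !mulrDl !mulrDr !mul1r !mulr1 mulrN mulNr opprK.
        rewrite addrACA [X in _ *: (X + _)]addrACA [X in _ *: (_ + X)]addrACA.
        rewrite !subrr addr0 add0r addrACA -mulr2n -[(1 + x * x) *+ 2]scaler_nat scalerA.
        by rewrite mulVf ?pnatr_eq0 // scale1r.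
      have hM y : nrm y <= 1 -> nrm (y * y) <= 1.
        by move=> hy; apply: le_trans (nrmM _ _) _; rewrite mulr_ile1 ?nrm_ge0.
      have := nrm_leD ((1 + x) * (1 + x)) ((1 - x) * (1 - x)).
      by move: (hM _ h1) (hM _ hN1); rewrite nrmZ nrmC_natV; lra.
    by have := nrm_ge0 (1 + c *: x); nra.
  move=> k. 
  elim/ltn_ind: k => -[|[|[|[|k]]]] IH.
  - by rewrite expr0 scale1r.
  - by rewrite expr1; apply: hi; rewrite ?mulC_ii //=; simpc.
  - by rewrite sqr_i scaleN1r.
  - by apply: hi; rewrite !exprS expr0 mulr1 mulC_ii mulrN1 ?mulrNN ?mulC_ii //=; simpc.
  - rewrite -addn4 exprD (_ : 'i ^+ 4 = 1) ?mulr1.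
      by apply: IH; exact: (leqW (leqW (leqW (leqnn _)))).
    by rewrite !exprS expr0 mulr1 mulC_ii mulrN1 mulrN mulC_ii opprK.
have gS y : good y -> good ((1 + 'i : R[i]) *: y).
  move=> gy k; rewrite scalerA mulrC -scalerA; apply: ball_rotate => //.
  by rewrite scalerA -exprS.
have g2 m : good ((2 ^ m)%:R *: x).
  elim: m => [|m IH]; first by rewrite expn0 scale1r.
  move=> k.
  (* [i^3 (1 + i)^2 = 2] *)
  have := gS _ (gS _ IH) k.+3; rewrite !scalerA.
  set c := _ * _; set d := _ * _; suff -> : c = d by [].
  have ii : 'i * 'i = -1 :> R[i] := mulC_ii.
  rewrite /c /d expnS natrM !exprS. by ring: ii.
apply: nrm0_eq; apply/eqP; rewrite eq_le nrm_ge0 andbT leNgt; apply/negP => x0.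
have [m hm] : exists m, 3 < (2 ^ m)%:R * nrm x.
  exists (Num.bound (3 / nrm x)).
  by rewrite -ltr_pdivrMr // natrX upper_nthrootP.
have := g2 m 0; rewrite expr0 scale1r => h.
have : nrm ((2 ^ m)%:R *: x) <= nrm (1 + (2 ^ m)%:R *: x) + nrm (- 1 : A).
  by apply: le_trans (nrm_leD _ _); rewrite addrC addrA addNr add0r.
rewrite nrmN nrm1 nrmZ nrmC_nat => hle.
have := le_trans (ltW hm) hle; move: h hle; move: (nrm _) => c; lra.
Qed.

End Extreme.

(** * Orthogonality of the ranges of the generators *)
Section Orthogonality.
Context {R : realType} {A : cstarAlgebra R} {n : nat} (S : 'I_n -> A).
Hypothesis S_iso : forall i, isometry (S i).
Hypothesis S_sum : \sum_(i < n) S i * star (S i) = 1.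

(** [1 - 2 p] is a unitary, and a compression does not increase its norm. *)
Lemma nrm_reflection (p s : A) : projection p -> isometry s ->
  nrm (1 - 2%:R *: (star s * p * s)) <= 1.
Proof.
move=> [pp sp] hs; have hu : isometry (1 - 2%:R *: p).
  rewrite /isometry scaler_nat mulr2n starB star1 starD sp; set u := p + p.
  have uu : u * u = u + u by rewrite mulrDl !mulrDr pp.
  by rewrite mulrBl mul1r mulrBr mulr1 uu opprB addrK subrK.
have -> : 1 - 2%:R *: (star s * p * s) = star s * (1 - 2%:R *: p) * s.
  by rewrite mulrBr mulrBl mulr1 hs -scalerAr -scalerAl.
by rewrite (le_trans (nrm_compress _ hs hs)) // nrm_isometry.
Qed.

Lemma isometry_projection (x : A) : isometry x -> projection (x * star x).
Proof.
move=> hx; split; last by rewrite starM starK.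
by rewrite mulrA -(mulrA x) hx mulr1.
Qed.

(** The compressions [h k = S_j^* S_k S_k^* S_j] sum to 1 and [h j = 1], so the
others sum to 0. Each of them satisfies [nrm (1 - 2 h) <= 1]; hence for [i]
different from [j] both [1 + (2 / n) h i] and [1 - (2 / n) h i] lie in the unit
ball, and [h i = 0] because 1 is an extreme point. *)
Lemma cuntz_orth i j : star (S i) * S j = (i == j)%:R.
Proof.
case: eqVneq => [<-|ij]; first exact: S_iso.
pose h k := star (S j) * (S k * star (S k)) * S j.
have hs k : star (h k) = h k by rewrite /h !starM !starK !mulrA.
have h_le k : nrm (1 - 2%:R *: h k) <= 1.
  by apply: nrm_reflection => //; exact: isometry_projection.
have hj : h j = 1 by rewrite /h mulrA S_iso mul1r S_iso.
have h_sum : \sum_k h k = 1.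
  by rewrite /h -mulr_suml -mulr_sumr S_sum mulr1 S_iso.
have n0 : (0 : R) < n%:R by rewrite ltr0n (leq_ltn_trans (leq0n i)) ?ltn_ord.
have h_i : h i = - \sum_(k | (k != i) && (k != j)) h k.
  apply/eqP; rewrite -addr_eq0; apply/eqP; move: h_sum.
  rewrite (bigD1 j) //= hj => /(canRL (addKr _)); rewrite addNr => h0.
  rewrite -[RHS]h0 [RHS](bigD1 i) //=; congr (_ + _); apply: eq_bigl => k.
  by rewrite andbC.
have hle1 : nrm (n%:R%:A + 2%:R *: h i) <= n%:R.
  have -> : n%:R%:A + 2%:R *: h i =
     \sum_k (if (k != i) && (k != j) then 1 - 2%:R *: h k else 1).
    rewrite (eq_bigr (fun k => 1 - (if (k != i) && (k != j) then 2%:R *: h k else 0))).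
      rewrite sumrB sumr_const card_ord scaler_nat h_i scalerN scaler_sumr.
      by rewrite -big_mkcond.
    by move=> k _; case: ifP; rewrite ?subr0.
  apply: le_trans (nrm_sum _ _) _; rewrite -[X in _ <= X%:R](card_ord n) -sumr_const.
  by apply: ler_sum => k _; case: ifP; rewrite ?nrm1.
have hle2 : nrm (n%:R%:A - 2%:R *: h i) <= n%:R.
  have -> : n%:R%:A - 2%:R *: h i = (n%:R - 1)%:A + (1 - 2%:R *: h i) :> A.
    by rewrite scalerBl scale1r addrA subrK.
  apply: le_trans (nrm_leD _ _) _; rewrite nrmZ nrm1 mulr1.
  have -> : nrm (n%:R - 1 : R[i]) = n%:R - 1.
    case: (n) n0 => [|m _]; first by rewrite ltxx.
    by rewrite -addn1 !natrD !addrK nrmC_nat.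
  by have := h_le i; lra.
have nC : (n%:R : R[i]) != 0 by rewrite pnatr_eq0 -lt0n -(ltr0n R).
have : ((n%:R)^-1 * 2%:R : R[i]) *: h i = 0.
  apply: one_extreme.
  - rewrite starZ hs; congr (_ *: _).
    by rewrite rmorphM fmorphV !rmorph_nat.
  - have -> : 1 + ((n%:R)^-1 * 2%:R : R[i]) *: h i = n%:R^-1 *: (n%:R%:A + 2%:R *: h i).
      by rewrite scalerDr !scalerA mulVf // scale1r.
    rewrite nrmZ nrmC_natV.
    by rewrite ler_pdivrMl // mulr1.
  - have -> : 1 - ((n%:R)^-1 * 2%:R : R[i]) *: h i = n%:R^-1 *: (n%:R%:A - 2%:R *: h i).
      by rewrite scalerBr !scalerA mulVf // scale1r.
    rewrite nrmZ nrmC_natV.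
    by rewrite ler_pdivrMl // mulr1.
move/eqP; rewrite scaler_eq0 mulf_eq0 invr_eq0 (negbTE nC) pnatr_eq0 /= => /eqP h0.
apply: nrm0_eq; apply/eqP; rewrite -(sqrf_eq0 (nrm _)) -nrm_starM starM starK.
by rewrite mulrA -(mulrA (star (S j))) -/(h i) h0 nrm0.
Qed.

End Orthogonality.

(** * Density of the monomials *)
Section Words.
Context {R : realType} {A : cstarAlgebra R} {n : nat} (S : 'I_n -> A).
Hypothesis hS : is_cuntz_algebra S.

Let S_iso i : isometry (S i). Proof. by case: hS. Qed.
Let S_sum : \sum_(i < n) S i * star (S i) = 1. Proof. by case: hS. Qed.
Local Notation W := (word_op S).

Lemma S_orth i j : star (S i) * S j = (i == j)%:R.
Proof. exact: cuntz_orth. Qed.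

Lemma word_nil : W [::] = 1.
Proof. by rewrite /word_op big_nil. Qed.

Lemma word_cons i mu : W (i :: mu) = S i * W mu.
Proof. by rewrite /word_op big_cons. Qed.

Lemma word_cat mu nu : W (mu ++ nu) = W mu * W nu.
Proof. by rewrite /word_op big_cat. Qed.

Lemma word_isometry mu : isometry (W mu).
Proof.
elim: mu => [|i mu IH]; first by rewrite word_nil; exact: isometry1.
by rewrite word_cons; exact: isometryM.
Qed.

Lemma word_cancel nu mu : exists k,
  [\/ star (W nu) * W mu = 0, star (W nu) * W mu = W k |
      star (W nu) * W mu = star (W k)].
Proof.
elim: nu mu => [|i nu IH] [|j mu].
- by exists [::]; rewrite word_nil star1 mulr1; constructor 2.
- by exists (j :: mu); rewrite word_nil star1 mul1r; constructor 2.
- by exists (i :: nu); rewrite word_nil mulr1; constructor 3.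
have [k hk] := IH mu; exists k.
rewrite !word_cons starM mulrA -(mulrA _ _ (S j)) S_orth.
by case: eqP => _; rewrite ?mulr1 // mulr0 mul0r; constructor.
Qed.

(** Closedness is phrased with approximants so that it can be checked and used
without the topology. *)
Definition closed_subspace (P : A -> Prop) : Prop :=
  [/\ forall x y, P x -> P y -> P (x + y),
      forall (c : R[i]) x, P x -> P (c *: x) &
      forall x, (forall e : R, 0 < e -> exists2 y, P y & nrm (x - y) < e) -> P x].

Lemma closed_subspace_comp (P : A -> Prop) (f : A -> A) (c : R) :
  closed_subspace P ->
  {morph f : x y / x + y} ->
  (forall a : R[i], exists b : R[i], forall x, f (a *: x) = b *: f x) ->
  (forall x, nrm (f x) <= c * nrm x) ->
  closed_subspace (fun x => P (f x)).
Proof.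
move=> [PD PZ PC] fD fZ fc; split=> [x y hx hy|a x hx|x hx].
- by rewrite fD; exact: PD.
- by have [b ->] := fZ a; exact: PZ.
have c1 : 0 < `|c| + 1 by rewrite ltr_wpDl.
have fB a b : f (a - b) = f a - f b.
  by apply/eqP; rewrite eq_sym subr_eq -fD subrK.
apply: PC => e e0; have [|y Py xy] := hx (e / (`|c| + 1)).
  exact: divr_gt0.
exists (f y) => //; rewrite -fB; apply: le_lt_trans (fc _) _.
move: xy; rewrite ltr_pdivlMr //; have := nrm_ge0 (x - y).
have := ler_norm c; nra.
Qed.

(** The closed span of the elements [S_mu S_nu^*], encoded as the intersection [B]
of all closed subspaces that contain them, is a star-subalgebra containing the
generators. With this encoding each factor of a product is treated by its own
induction, and no linear combination has to be written. *)
Lemma dense_ind (P : A -> Prop) : closed_subspace P ->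
  (forall mu nu, P (W mu * star (W nu))) -> forall x, P x.
Proof.
move=> hP hW x; case: (hS) => _ _ hgen.
have : cstar_generated (range S) x by rewrite hgen.
pose B := [set x : A | forall P, closed_subspace P ->
  (forall mu nu, P (W mu * star (W nu))) -> P x].
have BW mu nu : B (W mu * star (W nu)) by move=> Q _; exact.
have BD a b : B a -> B b -> B (a + b).
  by move=> ha hb Q hQ QW; case: (hQ) => QD _ _; apply: QD; [exact: ha|exact: hb].
have BZ (c : R[i]) a : B a -> B (c *: a).
  by move=> ha Q hQ QW; case: (hQ) => _ QZ _; apply: QZ; exact: ha.
have BC a : (forall e : R, 0 < e -> exists2 y, B y & nrm (a - y) < e) -> B a.
  move=> ha Q hQ QW; case: (hQ) => _ _ QC.
  by apply: QC => e /ha[y By ay]; exists y => //; exact: By.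
have cB : closed_subspace B by [].
move=> /(_ B (closed_approx BC)); apply => //; last first.
  by move=> _ [i _ <-]; have := BW [:: i] [::]; rewrite word_cons word_nil star1 !mulr1.
have BS a : B a -> B (star a).
  move=> ha; apply: (ha (fun a => B (star a))) => [|mu nu]; last by rewrite starM starK.
  apply: (@closed_subspace_comp B _ 1) => //; first exact: starD.
    by move=> c; exists (conjc c) => y; rewrite starZ.
  by move=> y; rewrite nrm_star mul1r.
have B0 : B 0.
  rewrite -(scale0r 1); apply: BZ.
  by have := BW [::] [::]; rewrite word_nil star1 mulr1.
have BMW a mu nu : B a -> B (a * (W mu * star (W nu))).
  move=> ha; apply: (ha (fun a => B (a * _))) => [|mu' nu'].
    apply: (@closed_subspace_comp B _ (nrm (W mu * star (W nu)))) => //.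
    - by move=> y z; rewrite mulrDl.
    - by move=> c; exists c => y; rewrite scalerAl.
    - by move=> y; rewrite mulrC; exact: nrmM.
  rewrite mulrA -(mulrA _ _ (W mu)); have [k [] ->] := word_cancel nu' mu.
  - by rewrite mulr0 mul0r; exact: B0.
  - by rewrite -word_cat.
  - by rewrite -mulrA -starM -word_cat.
split => //.
move=> a b ha hb; apply: (hb (fun b => B (a * b))) => [|mu nu]; last exact: BMW.
  apply: (@closed_subspace_comp B _ (nrm a)) => //.
  + by move=> y z; rewrite mulrDr.
  + by move=> c; exists c => y; rewrite scalerAr.
  + by move=> y; exact: nrmM.
Qed.

End Words.

(** * Averaging maps *)
Section Average.
Context {R : realType} {A : cstarAlgebra R} {n : nat}.
Implicit Types (t u : 'I_n -> A) (x y : A).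

(** Two families are allowed because the Fejer means below involve the matrix
entries, and not only the diagonal, of a compression by a row of isometries.
The case [t = u = S] is a left inverse of the canonical endomorphism. *)
Definition avg t u x : A := (n%:R^-1 : R[i]) *: \sum_c star (t c) * x * u c.

Lemma avgD t u : {morph avg t u : x y / x + y}.
Proof.
move=> x y; rewrite /avg -scalerDr -big_split /=.
under eq_bigr => c _ do rewrite mulrDr mulrDl.
reflexivity.
Qed.

Lemma avgZ t u (a : R[i]) x : avg t u (a *: x) = a *: avg t u x.
Proof.
rewrite /avg; under eq_bigr => c _ do rewrite -scalerAr -scalerAl.
by rewrite -scaler_sumr !scalerA mulrC.
Qed.

Lemma avg0 t u : avg t u 0 = 0.
Proof. by rewrite -[X in avg _ _ X](scale0r (0 : A)) avgZ scale0r. Qed.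

Lemma star_avg t u x : star (avg t u x) = avg u t (star x).
Proof.
rewrite /avg starZ fmorphV rmorph_nat star_sum.
under eq_bigr => c _ do rewrite !starM starK mulrA.
reflexivity.
Qed.

Lemma nrm_avg t u x : (forall c, isometry (t c)) -> (forall c, isometry (u c)) ->
  nrm (avg t u x) <= nrm x.
Proof.
move=> ht hu; have [n0|n0] := posnP n.
  rewrite /avg big1 ?scaler0 ?nrm0 ?nrm_ge0 // => c.
  by have := ltn_ord c; rewrite [X in (_ < X)%N]n0.
rewrite nrmZ nrmC_natV ler_pdivrMl ?ltr0n //.
apply: le_trans (nrm_sum _ _) _.
rewrite -[X in _ <= X%:R * _](card_ord n) mulr_natl -sumr_const.
by apply: ler_sum => c _; exact: nrm_compress.
Qed.

Lemma iter_avgD t u M : {morph iter M (avg t u) : x y / x + y}.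
Proof. by elim: M => [//|M IH] x y; rewrite !iterS IH avgD. Qed.

Lemma iter_avgZ t u M (a : R[i]) x :
  iter M (avg t u) (a *: x) = a *: iter M (avg t u) x.
Proof. by elim: M => //= M ->; rewrite avgZ. Qed.

Lemma iter_avg0 t u M : iter M (avg t u) 0 = 0.
Proof. by elim: M => //= M ->; rewrite avg0. Qed.

Lemma iter_avgB t u M x y :
  iter M (avg t u) (x - y) = iter M (avg t u) x - iter M (avg t u) y.
Proof. by rewrite iter_avgD -scaleN1r iter_avgZ scaleN1r. Qed.

Lemma star_iter_avg t M x : star (iter M (avg t t) x) = iter M (avg t t) (star x).
Proof. by elim: M => //= M IH; rewrite star_avg IH. Qed.

Lemma nrm_iter_avg t u M x : (forall c, isometry (t c)) ->
  (forall c, isometry (u c)) -> nrm (iter M (avg t u) x) <= nrm x.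
Proof.
move=> ht hu; elim: M => //= M; apply: le_trans; exact: nrm_avg.
Qed.

End Average.

(** * The limit of the averages *)
Section State.
Context {R : realType} {A : cstarAlgebra R} {n : nat} (S : 'I_n -> A).
Hypothesis hS : is_cuntz_algebra S.
Hypothesis hn : (2 <= n)%N.

Let S_iso i : isometry (S i). Proof. by case: hS. Qed.
Let S_sum : \sum_(i < n) S i * star (S i) = 1. Proof. by case: hS. Qed.
Local Notation W := (word_op S).

Local Notation T := (avg S S).

(** [c] is the value at [x] of the limit state. It is treated as a relation until
existence is known. *)
Definition state_at (x : A) (c : R[i]) : Prop := forall e : R, 0 < e ->
  exists M0, forall M, (M0 <= M)%N -> nrm (iter M T x - c%:A) <= e.

Let n_neq0 : (n%:R : R[i]) != 0.
Proof. by rewrite pnatr_eq0 -lt0n ltnW. Qed.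

Lemma pow_small (e : R) : 0 < e ->
  exists M0, forall M, (M0 <= M)%N -> (n%:R^-1) ^+ M <= e.
Proof.
move=> e0; exists (Num.bound e^-1) => M hM.
rewrite exprVn -[leRHS]invrK lef_pV2 ?posrE ?invr_gt0 ?exprn_gt0 ?ltr0n ?(ltnW hn) //.
apply: le_trans (ltW (upper_nthrootP hM)) _.
by rewrite lerXn2r ?nnegrE ?ler0n // ler_nat.
Qed.

(** Together with [avg_shift], the reason for convergence: equal first letters are
stripped, different ones give 0, and the letters of an unpaired word rotate
while a factor [1 / n] comes out. *)
Lemma avg_sandwich i j x : T (S i * x * star (S j)) = (n%:R^-1 *+ (i == j)) *: x.
Proof.
rewrite /avg (bigD1 i) //= big1 ?addr0 => [|c ci]; last first.
  by rewrite !mulrA S_orth // (negbTE ci) !mul0r.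
rewrite !mulrA S_iso mul1r -mulrA S_orth // eq_sym.
by case: eqP => _; rewrite ?mulr1 // mulr0 scaler0 mulr0n scale0r.
Qed.

Lemma avg_shift i x : T (S i * x) = n%:R^-1 *: (x * S i).
Proof.
rewrite /avg (bigD1 i) //= big1 ?addr0 => [|c ci]; last first.
  by rewrite !mulrA S_orth // (negbTE ci) !mul0r.
by rewrite !mulrA S_iso mul1r.
Qed.

Lemma avg1 : T 1 = 1.
Proof.
rewrite /avg (eq_bigr (fun=> 1)) => [|c _]; last by rewrite mulr1 S_iso.
by rewrite sumr_const card_ord -[(1 : A) *+ n]scaler_nat scalerA mulVf // scale1r.
Qed.

Lemma iter_avg1 M : iter M T 1 = 1.
Proof. by elim: M => //= M ->; exact: avg1. Qed.

Lemma state_at_bound x c : state_at x c -> nrm c <= nrm x.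
Proof.
move=> h; apply/ler_addgt0Pr => e e0; have [M0 hM] := h e e0.
have := hM _ (leqnn _); have := nrm_iter_avg M0 x S_iso S_iso.
have -> : nrm c = nrm (c%:A : A) by rewrite nrmZ nrm1 mulr1.
have := nrm_tri (iter M0 T x) c%:A 0; rewrite !subr0 nrmB; lra.
Qed.

Lemma state_atD x y c d : state_at x c -> state_at y d -> state_at (x + y) (c + d).
Proof.
move=> hx hy e e0; have e2 : 0 < e / 2 by lra.
have [M0 h0] := hx _ e2; have [M1 h1] := hy _ e2; exists (maxn M0 M1) => M.
rewrite geq_max => /andP[/h0 ? /h1 ?]; rewrite iter_avgD scalerDl opprD addrACA.
apply: le_trans (nrm_leD _ _) _; lra.
Qed.

Lemma state_atZ (a : R[i]) x c : state_at x c -> state_at (a *: x) (a * c).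
Proof.
move=> hx e e0; have a1 : 0 < nrm a + 1 by rewrite ltr_wpDl ?nrm_ge0.
have [|M0 h0] := hx (e / (nrm a + 1)); first exact: divr_gt0.
exists M0 => M /h0; rewrite iter_avgZ -scalerA -scalerBr nrmZ ler_pdivlMr //.
by have := nrm_ge0 (iter M T x - c%:A); nra.
Qed.

Lemma state_atB x y c d : state_at x c -> state_at y d -> state_at (x - y) (c - d).
Proof.
move=> hx hy; apply: state_atD => //.
by rewrite -scaleN1r -(mulN1r d); exact: state_atZ.
Qed.

Lemma state_at0 : state_at 0 0.
Proof. by move=> e e0; exists 0%N => M _; rewrite iter_avg0 scale0r subrr nrm0 ltW. Qed.

Lemma state_at1 : state_at 1 1.
Proof. by move=> e e0; exists 0%N => M _; rewrite iter_avg1 scale1r subrr nrm0 ltW. Qed.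

Lemma state_at_star x c : state_at x c -> state_at (star x) (conjc c).
Proof.
move=> hx e e0; have [M0 h0] := hx _ e0; exists M0 => M /h0.
by rewrite -star_iter_avg -{2}star1 -starZ -starB nrm_star.
Qed.

Lemma state_at_unavg x c : state_at (T x) c -> state_at x c.
Proof.
move=> hx e e0; have [M0 h0] := hx _ e0; exists M0.+1 => -[//|M].
by rewrite ltnS iterSr => /h0.
Qed.

Lemma state_at_avg x c : state_at x c -> state_at (T x) c.
Proof.
move=> hx e e0; have [M0 h0] := hx _ e0; exists M0 => M hM.
by rewrite -iterSr; apply: h0; exact: leqW.
Qed.

Lemma state_at_uniq x c d : state_at x c -> state_at x d -> c = d.
Proof.
move=> hc hd; apply/eqP; rewrite -subr_eq0; apply/eqP/nrm_eq0 => e e0.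
have /state_at_bound := state_atB hc hd.
by rewrite subrr nrm0 => /le_trans; apply; exact: ltW.
Qed.

(** The averages of [S_mu] are [n^-M] times words of the same length. *)
Lemma state_at_word mu : mu <> [::] -> state_at (W mu) 0.
Proof.
move=> mu0.
have hw M nu : nu <> [::] -> nrm (iter M T (W nu)) <= (n%:R^-1) ^+ M.
  elim: M nu => [|M IH] [//|i nu] _.
    by rewrite expr0 /= nrm_isometry //; exact: word_isometry.
  have hr : nu ++ [:: i] <> [::] by case: (nu).
  rewrite iterSr word_cons avg_shift iter_avgZ nrmZ nrmC_natV exprS.
  have := IH _ hr; rewrite word_cat word_cons word_nil mulr1 => h.
  by apply: ler_wpM2l => //; rewrite invr_ge0 ler0n.
move=> e /pow_small[M0 h0]; exists M0 => M /h0; rewrite scale0r subr0.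
by apply: le_trans; exact: hw.
Qed.

Lemma state_at_words mu nu : exists c, state_at (W mu * star (W nu)) c.
Proof.
elim: mu nu => [|i mu IH] [|j nu].
- by exists 1; rewrite word_nil star1 mulr1; exact: state_at1.
- exists (conjc 0); rewrite word_nil mul1r; apply: state_at_star.
  exact: state_at_word.
- by exists 0; rewrite word_nil star1 mulr1; exact: state_at_word.
have [c hc] := IH nu; exists (n%:R^-1 *+ (i == j) * c).
rewrite !word_cons starM mulrA -(mulrA (S i)); apply: state_at_unavg.
by rewrite avg_sandwich; exact: state_atZ.
Qed.

(** The monomials have a limit, and the set of elements with a limit is closed: the
limits of approximants form a Cauchy family because each average is a
contraction. *)
Lemma state_at_exists x : exists c, state_at x c.
Proof.
move: x; apply: (dense_ind hS); last exact: state_at_words.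
split=> [x y [c hc] [d hd]|a x [c hc]|x hx].
- by exists (c + d); exact: state_atD.
- by exists (a * c); exact: state_atZ.
have /choice[f hf] : forall e : R, exists yc : A * R[i],
    0 < e -> state_at yc.1 yc.2 /\ nrm (x - yc.1) < e.
  move=> e; have [e0|e0] := ltP 0 e; last by exists (0, 0).
  by have [y [c hc] xy] := hx e e0; exists (y, c).
have [|c hc] := @complex_limit _ (fun e => (f e).2).
  move=> e d e0 d0; have [he xe] := hf e e0; have [hd xd] := hf d d0.
  apply: le_trans (state_at_bound (state_atB he hd)) _; apply: le_trans (nrm_tri x _ _) _.
  by rewrite nrmB; apply: lerD; exact: ltW.
exists c => e e0; have d0 : 0 < e / 4 by lra.
have [he xe] := hf _ d0; have [M0 hM] := he _ d0; exists M0 => M /hM h1.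
have h2 := hc _ d0; apply: le_trans (nrm_tri (iter M T (f (e / 4)).1) _ _) _.
have h3 := nrm_iter_avg M (x - (f (e / 4)).1) S_iso S_iso.
rewrite iter_avgB in h3.
have := nrm_tri ((f (e / 4)).2%:A : A) (iter M T (f (e / 4)).1) c%:A.
rewrite -scalerBl nrmZ nrm1 mulr1; lra.
Qed.

End State.

(** * Positivity of the limit functional *)
Section Positivity.
Context {R : realType} {A : cstarAlgebra R} {n : nat} (S : 'I_n -> A).
Hypothesis hS : is_cuntz_algebra S.
Hypothesis hn : (2 <= n)%N.

Let S_iso i : isometry (S i). Proof. by case: hS. Qed.
Let S_sum : \sum_(i < n) S i * star (S i) = 1. Proof. by case: hS. Qed.
Local Notation W := (word_op S).
Let n_neq0 : (n%:R : R[i]) != 0.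
Proof. by rewrite pnatr_eq0 -lt0n ltnW. Qed.

Variable phi : A -> R[i].
Hypothesis phiP : forall x, state_at S x (phi x).

Lemma phi_uniq x c : state_at S x c -> phi x = c.
Proof. exact: state_at_uniq. Qed.

Lemma phiD x y : phi (x + y) = phi x + phi y.
Proof. by apply: phi_uniq; exact: state_atD. Qed.

Lemma phiZ (a : R[i]) x : phi (a *: x) = a * phi x.
Proof. by apply: phi_uniq; exact: state_atZ. Qed.

Lemma phiB x y : phi (x - y) = phi x - phi y.
Proof. by apply: phi_uniq; exact: state_atB. Qed.

Lemma phi0 : phi 0 = 0.
Proof. by apply: phi_uniq; exact: state_at0. Qed.

Lemma phi1 : phi 1 = 1.
Proof. by apply: phi_uniq; exact: state_at1. Qed.

Lemma phi_sum I (r : seq I) (F : I -> A) :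
  phi (\sum_(i <- r) F i) = \sum_(i <- r) phi (F i).
Proof. by apply: (big_morph _ phiD phi0). Qed.

Lemma phi_star x : phi (star x) = conjc (phi x).
Proof. by apply: phi_uniq; exact: state_at_star. Qed.

Lemma phi_le x : nrm (phi x) <= nrm x.
Proof. exact: state_at_bound (phiP x). Qed.

Lemma phi_avg x : phi (avg S S x) = phi x.
Proof. by apply: phi_uniq; exact: state_at_avg. Qed.

Lemma phi_word mu : mu <> [::] -> phi (W mu) = 0.
Proof. by move=> mu0; apply: phi_uniq; exact: state_at_word. Qed.

(** The KMS condition of [phi] for the gauge action, in algebraic form. *)
Lemma phi_shift mu x : phi (W mu * x) = n%:R^-1 ^+ size mu * phi (x * W mu).
Proof.
elim: mu x => [|i mu IH] x; first by rewrite word_nil mul1r !mulr1 mul1r.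
rewrite !word_cons -mulrA -phi_avg avg_shift // phiZ -mulrA IH /= exprS.
by rewrite -!mulrA.
Qed.

Lemma phi_shift_star mu x :
  phi (x * star (W mu)) = n%:R^-1 ^+ size mu * phi (star (W mu) * x).
Proof.
rewrite -[x]starK -!starM !phi_star phi_shift rmorphM rmorphXn fmorphV.
by rewrite rmorph_nat.
Qed.

Lemma phi_corner x : phi x = n%:R^-1 * \sum_i phi (star (S i) * x * S i).
Proof. rewrite -phi_avg /avg phiZ phi_sum. reflexivity. Qed.

(** The linear span of the [S_mu], built from the identity
[h = c + sum_i S_i h_i]: this grading by first letters makes the
nonnegativity of [phi (h^* h)] an induction. *)
Inductive creation : A -> Prop :=
| creation0 : creation 0
| creation_step (c : R[i]) (f : 'I_n -> A) :
    (forall i, creation (f i)) -> creation (c%:A + \sum_i S i * f i).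

Lemma creationD x y : creation x -> creation y -> creation (x + y).
Proof.
move=> hx; elim: hx y => [|c f hf IH] y hy; first by rewrite add0r.
case: hy => [|d g hg]; first by rewrite addr0; exact: creation_step.
rewrite addrACA -scalerDl -big_split /=.
under eq_bigr do rewrite -mulrDr.
by apply: creation_step => i; exact: IH.
Qed.

Lemma creationZ (a : R[i]) x : creation x -> creation (a *: x).
Proof.
elim=> [|c f hf IH]; first by rewrite scaler0; exact: creation0.
rewrite scalerDr scalerA scaler_sumr; under eq_bigr do rewrite scalerAr.
exact: creation_step.
Qed.

Lemma creation_word mu : creation (W mu).
Proof.
elim: mu => [|i mu IH].
  rewrite word_nil (_ : 1 = 1%:A + \sum_(i < n) S i * 0).
    by apply: creation_step => i; exact: creation0.
  by rewrite big1 ?addr0 ?scale1r // => i _; rewrite mulr0.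
rewrite word_cons (_ : S i * W mu =
    0%:A + \sum_j S j * (if j == i then W mu else 0)).
  by apply: creation_step => j; case: ifP => // _; exact: creation0.
rewrite scale0r add0r (bigD1 i) //= eqxx big1 ?addr0 // => j /negbTE ->.
by rewrite mulr0.
Qed.

(** [phi] only sees the constant coefficient of a sum of words. *)
Lemma phi_word_creation mu h : mu <> [::] -> creation h -> phi (W mu * h) = 0.
Proof.
move=> mu0 hh; elim: hh mu mu0 => [|c f hf IH] mu mu0.
  by rewrite mulr0 phi0.
rewrite mulrDr phiD -scalerAr mulr1 phiZ phi_word // mulr0 add0r.
rewrite mulr_sumr phi_sum big1 // => i _.
have -> : W mu * (S i * f i) = W (mu ++ [:: i]) * f i.
  by rewrite word_cat word_cons word_nil mulr1 mulrA.
by apply: IH; case: (mu).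
Qed.

(** With [h = c + g] and [g = sum_i S_i f_i] the cross terms have value 0, and
[g^* g = sum_i f_i^* f_i]. *)
Lemma creation_ge0 h : creation h -> 0 <= complex.Re (phi (star h * h)).
Proof.
elim=> [|c f hf IH]; first by rewrite mulr0 phi0.
set g := \sum_i S i * f i.
have g0 : phi g = 0.
  rewrite phi_sum big1 // => i _.
  have := @phi_word_creation [:: i] (f i).
  by rewrite word_cons word_nil mulr1; apply.
have gg : star g * g = \sum_i star (f i) * f i.
  rewrite star_sum mulr_suml; apply: eq_bigr => i _.
  rewrite mulr_sumr (bigD1 i) //= big1 ?addr0 => [|j ji].
    by rewrite starM mulrA -(mulrA (star (f i))) S_iso mulr1.
  rewrite starM mulrA -(mulrA (star (f i))) S_orth //.
  by rewrite eq_sym (negbTE ji) mulr0 mul0r.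
rewrite starD starZ star1 mulrDl !mulrDr -!scalerAl -!scalerAr !mul1r !mulr1.
rewrite !phiD gg !phiZ phi_star g0 phi1 conjc0 !mulr0 addr0 add0r mulr1.
rewrite phi_sum !raddfD /= raddf_sum addr_ge0 ?sumr_ge0 //.
  by case: c => a b /=; nra.
by move=> i _; exact: IH.
Qed.

(** Iterating [phi_corner], [phi (y^* y)] is the mean of the numbers
[phi ((y S_nu)^* (y S_nu))] over the words [nu] of length [N]. *)
Lemma eventually_creation_ge0 (y : A) N :
  (forall nu, size nu = N -> creation (y * W nu)) ->
  0 <= complex.Re (phi (star y * y)).
Proof.
elim: N y => [|N IH] y hy.
  by apply: creation_ge0; have := hy [::] erefl; rewrite word_nil mulr1.
rewrite phi_corner -(rmorph_nat (real_complex R)) -fmorphV.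
rewrite mulr_sumr raddf_sum sumr_ge0 // => i _.
have -> : star (S i) * (star y * y) * S i = star (y * S i) * (y * S i).
  by rewrite starM !mulrA.
have := IH (y * S i); case: (phi _) => a b h /=.
rewrite mul0r subr0 mulr_ge0 ?invr_ge0 ?ler0n //; apply: h => nu nuN.
by rewrite -mulrA -word_cons; apply: hy; rewrite /= nuN.
Qed.

Lemma word_star_creation mu nu : (size mu <= size nu)%N ->
  exists2 k, star (W mu) * W nu = 0 \/ star (W mu) * W nu = W k &
   (size k <= size nu)%N.
Proof.
elim: mu nu => [|i mu IH] [|j nu] //=.
- by exists [::] => //; right; rewrite word_nil star1 mulr1.
- by exists (j :: nu) => //; right; rewrite word_nil star1 mul1r.
rewrite ltnS => /IH[k hk sk]; exists k; last exact: leqW.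
rewrite !word_cons starM mulrA -(mulrA (star (W mu))) S_orth //.
by case: eqP => _; rewrite ?mulr1 // mulr0 mul0r; left.
Qed.

(** Nonnegativity on all of the algebra, by approximation: for a polynomial [y] in
the generators and their adjoints every product [y S_nu] with [nu] long
enough lies in the span of the [S_mu]. *)
Lemma phi_ge0 x : 0 <= complex.Re (phi (star x * x)).
Proof.
pose good y := exists N, forall nu, (N <= size nu)%N -> creation (y * W nu).
have happ : forall x, forall e : R, 0 < e -> exists2 y, good y & nrm (x - y) < e.
  apply: (dense_ind hS) => [|mu nu e e0]; last first.
    exists (W mu * star (W nu)); last by rewrite subrr nrm0.
    exists (size nu) => k /word_star_creation[l [] hl _]; rewrite -mulrA hl.
      by rewrite mulr0; exact: creation0.
    by rewrite -word_cat; exact: creation_word.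
  split=> [a b ha hb e e0|c a ha e e0|a ha e e0].
  - have e2 : 0 < e / 2 by lra.
    have [y [N hN] ay] := ha _ e2; have [z [M hM] bz] := hb _ e2.
    exists (y + z).
      exists (maxn N M) => nu; rewrite geq_max => /andP[/hN h1 /hM h2].
      by rewrite mulrDl; exact: creationD.
    rewrite opprD addrACA; apply: le_lt_trans (nrm_leD _ _) _; lra.
  - have c1 : 0 < nrm c + 1 by rewrite ltr_wpDl ?nrm_ge0.
    have [|y [N hN] ay] := ha (e / (nrm c + 1)); first exact: divr_gt0.
    exists (c *: y).
      by exists N => nu /hN h; rewrite -scalerAl; exact: creationZ.
    rewrite -scalerBr nrmZ; move: ay; rewrite ltr_pdivlMr //.
    by have := nrm_ge0 (a - y); nra.
  - have e2 : 0 < e / 2 by lra.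
    have [b hb ab] := ha _ e2; have [y gy yb] := hb _ e2; exists y => //.
    apply: le_lt_trans (nrm_tri b _ _) _; lra.
rewrite leNgt; apply/negP => neg.
set r := complex.Re _ in neg.
have k0 : 0 < 2 * nrm x + 1 by have := nrm_ge0 x; lra.
pose e := Num.min 1 (- r / (2 * nrm x + 1)).
have e0 : 0 < e by rewrite /e lt_min ltr01 divr_gt0 ?oppr_gt0.
have e1 : e <= 1 by rewrite /e ge_min lexx.
have er : e * (2 * nrm x + 1) <= - r.
  by rewrite -ler_pdivlMr // /e ge_min lexx orbT.
have [y [N hN] xy] := happ x e e0.
have yp : 0 <= complex.Re (phi (star y * y)).
  by apply: (@eventually_creation_ge0 _ N) => nu nuN; apply: hN; rewrite nuN.
have hd : nrm (star x * x - star y * y) < - r.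
  have -> : star x * x - star y * y = star (x - y) * x + star y * (x - y).
    by rewrite starB mulrBl mulrBr addrA subrK.
  apply: le_lt_trans (nrm_leD _ _) _.
  have := nrmM (star (x - y)) x; have := nrmM (star y) (x - y).
  rewrite !nrm_star => h1 h2.
  have hy : nrm y <= nrm x + e.
    have := nrm_tri x y 0; rewrite !subr0 nrmB; lra.
  have := nrm_ge0 x; have := nrm_ge0 y; have := nrm_ge0 (x - y); nra.
have := le_lt_trans (phi_le _) hd; rewrite phiB => /(le_lt_trans (nrmC_Re _)).
rewrite raddfB /= ltr_norml -/r => /andP[]; lra.
Qed.

(** The degenerate case of the Cauchy-Schwarz inequality: for [z = phi (x^* y)]
the real part of [phi] at the square of [x - z^* y] is [- 2 |z|^2]. *)
Lemma phi_null x y : complex.Re (phi (star x * x)) = 0 ->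
  complex.Re (phi (star y * y)) = 0 -> phi (star x * y) = 0.
Proof.
move=> hx hy; set z := phi _.
have hz : phi (star y * x) = conjc z by rewrite -phi_star starM starK.
have := phi_ge0 (x - conjc z *: y).
rewrite starB starZ conjcK mulrBl !mulrBr -!scalerAl -!scalerAr !phiB !phiZ.
rewrite -/z hz !raddfB /= hx.
move: hy; case: (phi (star y * y)) => p q /= ->; case: z {hz} => a b /=.
move=> h; apply/eqP; rewrite eq_complex /=; apply/andP; split; apply/eqP; nra.
Qed.

(** By [phi_corner] a mean of nonnegative numbers is 0. *)
Lemma phi_null_word x mu : complex.Re (phi (star x * x)) = 0 ->
  complex.Re (phi (star (x * W mu) * (x * W mu))) = 0.
Proof.
elim: mu x => [|i mu IH] x hx; first by rewrite word_nil mulr1.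
rewrite word_cons [x * _]mulrA; apply: IH; apply/eqP; rewrite eq_le phi_ge0 andbT.
have : \sum_j complex.Re (phi (star (x * S j) * (x * S j))) = 0.
  move: hx; rewrite phi_corner -(rmorph_nat (real_complex R)) -fmorphV.
  rewrite -raddf_sum /=; under [in X in _ -> X = _]eq_bigr do rewrite starM.
  under [in X in X = _ -> _]eq_bigr do rewrite !mulrA.
  under [in X in _ -> X = _]eq_bigr do rewrite !mulrA.
  case: (\sum_j _) => a b /=; rewrite mul0r subr0 => /eqP.
  by rewrite mulf_eq0 invr_eq0 pnatr_eq0 -(pnatr_eq0 R[i]) (negbTE n_neq0) => /eqP.
by rewrite (bigD1 i) //= => /eqP; rewrite paddr_eq0 ?sumr_ge0 ?phi_ge0 //
  => [/andP[/eqP -> //]|j _]; exact: phi_ge0.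
Qed.

End Positivity.

(** * Sequences of averages over orthonormal rows *)
Section Vanishing.
Context {R : realType}.
Implicit Types f g : nat -> R.

Definition vanishing f : Prop := forall e : R, 0 < e ->
  exists M0, forall M, (M0 <= M)%N -> f M <= e.

Lemma vanishing_le f g : (forall M, f M <= g M) -> vanishing g -> vanishing f.
Proof. by move=> fg hg e /hg[M0 h]; exists M0 => M /h; exact: le_trans. Qed.

Lemma vanishingD f g : vanishing f -> vanishing g ->
  vanishing (fun M => f M + g M).
Proof.
move=> hf hg e e0; have e2 : 0 < e / 2 by lra.
have [M0 h0] := hf _ e2; have [M1 h1] := hg _ e2; exists (maxn M0 M1) => M.
rewrite geq_max => /andP[/h0 ? /h1 ?]; lra.
Qed.

Lemma vanishing_sum I (r : seq I) (f : I -> nat -> R) :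
  (forall i, vanishing (f i)) -> vanishing (fun M => \sum_(i <- r) f i M).
Proof.
move=> hf; elim: r => [|i r IH].
  by move=> e e0; exists 0%N => M _; rewrite big_nil ltW.
apply: vanishing_le (vanishingD (hf i) IH) => M.
by rewrite big_cons.
Qed.

End Vanishing.

Section RowAverage.
Context {R : realType} {A : cstarAlgebra R} {n L : nat}.
Hypothesis n0 : (0 < n)%N.
Variable a : 'I_L -> 'I_n -> A.
Hypothesis a_iso : forall i c, isometry (a i c).

(** For [M = 0] this is the compression of [x] by the row isometry
[L^-1/2 sum_i t_i]; the further averages run over words in the letters [a i]. *)
Definition row_avg (t : 'I_L -> A) M x : A :=
  (L%:R^-1 : R[i]) *: \sum_i \sum_j iter M (avg (a i) (a j)) (star (t i) * x * t j).

Lemma row_avgS t M x : row_avg t M.+1 x =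
  (n%:R^-1 : R[i]) *: \sum_c row_avg (fun i => t i * a i c) M x.
Proof.
rewrite /row_avg -scaler_sumr scalerA [X in _ = X *: _]mulrC -scalerA; congr (_ *: _).
rewrite [in RHS]exchange_big scaler_sumr; apply: eq_bigr => i _ /=.
rewrite [in RHS]exchange_big scaler_sumr; apply: eq_bigr => j _ /=.
rewrite -[LHS]iterS iterSr [X in iter _ _ X]/avg iter_avgZ; congr (_ *: _).
rewrite (big_morph _ (iter_avgD _ _ _) (iter_avg0 _ _ _)).
by apply: eq_bigr => c _; rewrite starM !mulrA.
Qed.

(** For [M = 0] the value is [L^-1 Y^* x Y] with [Y] the sum of the [t i], and
[Y^* Y = L]. By [row_avgS] each further step is a mean over the orthonormal
families [t i * a i c]. *)
Lemma nrm_row_avg t M x : (forall i j, star (t i) * t j = (i == j)%:R) ->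
  nrm (row_avg t M x) <= nrm x.
Proof.
elim: M t => [|M IH] t ht.
  have [L0|L0] := posnP L.
    rewrite /row_avg big1 ?scaler0 ?nrm0 ?nrm_ge0 // => c.
    by have := ltn_ord c; rewrite [X in (_ < X)%N]L0.
  set Y := \sum_j t j.
  have YY : nrm Y ^+ 2 = L%:R.
    rewrite -nrm_starM star_sum mulr_suml (eq_bigr (fun=> 1)) => [|i _].
      rewrite sumr_const card_ord -[(1 : A) *+ L]scaler_nat nrmZ nrm1 mulr1.
      exact: nrmC_nat.
    rewrite mulr_sumr (bigD1 i) //= big1 ?addr0 ?ht ?eqxx // => j ji.
    by rewrite ht eq_sym (negbTE ji).
  have -> : row_avg t 0 x = (L%:R^-1 : R[i]) *: (star Y * x * Y).
    rewrite /row_avg star_sum mulr_suml mulr_suml; congr (_ *: _).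
    by apply: eq_bigr => i _; rewrite mulr_sumr.
  rewrite nrmZ nrmC_natV ler_pdivrMl ?ltr0n // -YY.
  apply: le_trans (nrmM _ _) _; rewrite expr2 mulrAC.
  rewrite ler_wpM2r ?nrm_ge0 //; apply: le_trans (nrmM _ _) _.
  by rewrite nrm_star.
rewrite row_avgS nrmZ nrmC_natV ler_pdivrMl ?ltr0n //.
apply: le_trans (nrm_sum _ _) _.
rewrite -[X in _ <= X%:R * _](card_ord n) mulr_natl -sumr_const.
apply: ler_sum => c _; apply: IH => i j.
rewrite starM mulrA -(mulrA (star (a i c))) ht.
by case: eqP => [->|_]; rewrite ?mulr1 ?a_iso // mulr0 mul0r.
Qed.

Lemma row_avgD t M x y : row_avg t M (x + y) = row_avg t M x + row_avg t M y.
Proof.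
rewrite /row_avg -scalerDr -big_split; congr (_ *: _); apply: eq_bigr => i _ /=.
rewrite -big_split; apply: eq_bigr => j _ /=.
by rewrite mulrDr mulrDl iter_avgD.
Qed.

Lemma row_avgZ t M (b : R[i]) x : row_avg t M (b *: x) = b *: row_avg t M x.
Proof.
rewrite /row_avg scalerA mulrC -scalerA; congr (_ *: _).
rewrite scaler_sumr; apply: eq_bigr => i _; rewrite scaler_sumr.
by apply: eq_bigr => j _; rewrite -scalerAr -scalerAl iter_avgZ.
Qed.

Lemma row_avgB t M x y : row_avg t M (x - y) = row_avg t M x - row_avg t M y.
Proof. by rewrite row_avgD -scaleN1r row_avgZ scaleN1r. Qed.

End RowAverage.

(** * The canonical shift endomorphism *)
Section Shift.
Context {R : realType} {A : cstarAlgebra R} {n : nat} (S : 'I_n -> A).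
Hypothesis hS : is_cuntz_algebra S.

Let S_iso i : isometry (S i). Proof. by case: hS. Qed.
Let S_sum : \sum_(i < n) S i * star (S i) = 1. Proof. by case: hS. Qed.
Local Notation W := (word_op S).

Definition shift (x : A) : A := \sum_i S i * x * star (S i).

Lemma shift_S x i : shift x * S i = S i * x.
Proof.
rewrite /shift mulr_suml (bigD1 i) //= big1 ?addr0 => [|j ji].
  by rewrite -mulrA S_iso mulr1.
by rewrite -mulrA S_orth // (negbTE ji) mulr0.
Qed.

Lemma star_shift x : star (shift x) = shift (star x).
Proof.
by rewrite /shift star_sum; apply: eq_bigr => i _; rewrite !starM starK mulrA.
Qed.

Lemma shiftM x y : shift (x * y) = shift x * shift y.
Proof.
rewrite {3}/shift mulr_sumr; apply: eq_bigr => i _.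
by rewrite !mulrA shift_S.
Qed.

Lemma shift1 : shift 1 = 1.
Proof. by rewrite /shift -[RHS]S_sum; apply: eq_bigr => i _; rewrite mulr1. Qed.

Lemma shift0 : shift 0 = 0.
Proof. by rewrite /shift big1 // => i _; rewrite mulr0 mul0r. Qed.

Lemma star_iter_shift k x : star (iter k shift x) = iter k shift (star x).
Proof. by elim: k => //= k <-; rewrite star_shift. Qed.

Lemma iter_shiftM k x y : iter k shift (x * y) = iter k shift x * iter k shift y.
Proof. by elim: k => //= k ->; rewrite shiftM. Qed.

Lemma iter_shift1 k : iter k shift 1 = 1.
Proof. by elim: k => //= k ->; rewrite shift1. Qed.

Lemma iter_shift0 k : iter k shift 0 = 0.
Proof. by elim: k => //= k ->; rewrite shift0. Qed.

Lemma iter_shift_isometry k x : isometry x -> isometry (iter k shift x).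
Proof.
by rewrite /isometry star_iter_shift -iter_shiftM => ->; rewrite iter_shift1.
Qed.

Lemma iter_shift_word mu k x :
  iter (size mu + k) shift x * W mu = W mu * iter k shift x.
Proof.
elim: mu => [|i mu IH]; first by rewrite word_nil mulr1 mul1r.
by rewrite word_cons /= mulrA shift_S -mulrA IH mulrA.
Qed.

Lemma word_star_iter_shift nu k x :
  star (W nu) * iter (size nu + k) shift x = iter k shift x * star (W nu).
Proof.
by rewrite -[LHS]starK starM starK star_iter_shift iter_shift_word starM
  star_iter_shift starK.
Qed.

(** A monomial of gauge degree [d = |mu| - |nu|] moves past a far shifted element
at the price of [d] additional shifts; this is how shifted isometries detect
the degree. *)
Lemma sandwich_iter_shift mu nu k x :
  W mu * star (W nu) * iter (size nu + k) shift x =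
  iter (size mu + k) shift x * (W mu * star (W nu)).
Proof. by rewrite -mulrA word_star_iter_shift mulrA -iter_shift_word mulrA. Qed.

Lemma star_S_avg k (u : 'I_n -> A) M x d :
  star (S d) * iter M (avg (fun c => iter k.+1 shift (S c)) u) x =
  iter M (avg (fun c => iter k shift (S c)) u) (star (S d) * x).
Proof.
elim: M => //= M <-; rewrite /avg -scalerAr mulr_sumr; congr (_ *: _).
by apply: eq_bigr => c _; rewrite !mulrA -[star (S d) * star _]starM shift_S starM.
Qed.

Lemma avg_S l (t : 'I_n -> A) M x d :
  iter M (avg t (fun c => iter l.+1 shift (S c))) x * S d =
  iter M (avg t (fun c => iter l shift (S c))) (x * S d).
Proof.
elim: M => //= M <-; rewrite /avg -scalerAl mulr_suml; congr (_ *: _).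
by apply: eq_bigr => c _; rewrite -!mulrA /= shift_S.
Qed.

(** The matrix entries [S_mu^* z S_nu], with [|mu| = k] and [|nu| = l], of a shifted
average [z] are plain averages, and there are finitely many of them. *)
Lemma vanishing_avg k l x :
  (forall mu nu, size mu = k -> size nu = l ->
    vanishing (fun M => nrm (iter M (avg S S) (star (W mu) * x * W nu)))) ->
  vanishing (fun M => nrm (iter M (avg (fun c => iter k shift (S c))
                                       (fun c => iter l shift (S c))) x)).
Proof.
elim: k x => [|k IHk] x h.
  elim: l x h => [|l IHl] x h.
    by have := h [::] [::] erefl erefl; rewrite word_nil star1 mul1r mulr1.
  have hd d : vanishing (fun M => nrm (iter M (avg S
       (fun c => iter l shift (S c))) (x * S d))).
    apply: IHl => mu nu mu0 nul; have := h mu (d :: nu) mu0.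
    by rewrite /= nul word_cons !mulrA; apply.
  apply: vanishing_le (vanishing_sum (index_enum 'I_n) hd) => M.
  rewrite -[X in nrm X]mulr1 -S_sum mulr_sumr.
  apply: le_trans (nrm_sum _ _) _; apply: ler_sum => d _.
  rewrite mulrA avg_S; apply: le_trans (nrmM _ _) _.
  by rewrite nrm_star (nrm_isometry (S_iso d)) mulr1.
have hd d : vanishing (fun M => nrm (iter M (avg (fun c => iter k shift (S c))
     (fun c => iter l shift (S c))) (star (S d) * x))).
  apply: IHk => mu nu muk nul; have := h (d :: mu) nu _ nul.
  by rewrite /= muk word_cons starM !mulrA; apply.
apply: vanishing_le (vanishing_sum (index_enum 'I_n) hd) => M.
rewrite -[X in nrm X]mul1r -S_sum mulr_suml.
apply: le_trans (nrm_sum _ _) _; apply: ler_sum => d _.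
rewrite -mulrA star_S_avg; apply: le_trans (nrmM _ _) _.
by rewrite (nrm_isometry (S_iso d)) mul1r.
Qed.

End Shift.

(** * Fejer means and faithfulness *)
Section Faithful.
Context {R : realType} {A : cstarAlgebra R} {n : nat} (S : 'I_n -> A).
Hypothesis hS : is_cuntz_algebra S.
Hypothesis hn : (2 <= n)%N.

Let S_iso i : isometry (S i). Proof. by case: hS. Qed.
Local Notation W := (word_op S).
Local Notation shift := (shift S).

Let i0 : 'I_n := Ordinal (ltnW hn).
Let i1 : 'I_n := Ordinal hn.

(** A word without small periods, which makes the shifts of its isometry
orthogonal. *)
Definition spike m : seq 'I_n := nseq m i0 ++ [:: i1].

(** For [T = S_0^m S_1] one has [(S_0^k)^* shift^k T = T (S_0^k)^*], so that the
product contains the factor [S_1^* S_0^k S_1 = 0]. *)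
Lemma spike_orth0 m k : (0 < k <= m)%N ->
  star (W (spike m)) * iter k shift (W (spike m)) = 0.
Proof.
move=> /andP[k0 km].
have e1 : W (spike m) = W (nseq k i0) * (W (nseq (m - k) i0) * S i1).
  rewrite /spike -{1}(subnKC km) nseqD -catA !word_cat word_cons word_nil.
  by rewrite mulr1.
have e2 : W (spike m) = W (nseq (m - k) i0) * (W (nseq k i0) * S i1).
  rewrite /spike -{1}(subnK km) nseqD -catA !word_cat word_cons word_nil.
  by rewrite mulr1.
have := word_star_iter_shift hS (nseq k i0) 0 (W (spike m)).
rewrite size_nseq addn0 /= => hk.
rewrite {1}e1 starM -mulrA hk e2 starM -!mulrA.
rewrite (mulrA (star (W (nseq (m - k) i0)))) word_isometry // mul1r.
rewrite -(prednK k0) /= word_cons -!mulrA (mulrA (star (S i1))) S_orth //.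
by rewrite (_ : (i1 == i0) = false) // mul0r.
Qed.

Lemma spike_orth m p q : (p <= q + m)%N -> (q <= p + m)%N ->
  star (iter p shift (W (spike m))) * iter q shift (W (spike m)) = (p == q)%:R.
Proof.
wlog pq : p q / (p <= q)%N => [th|] hp hq.
  have [/th|/ltnW/th h] := leqP p q; first exact.
  by rewrite -[LHS]starK starM starK h // eq_sym; case: eqP; rewrite ?star1 ?star0.
rewrite star_iter_shift -{1}(subnKC pq) iterD -iter_shiftM //.
case: eqVneq => [->|npq].
  by rewrite subnn /= word_isometry // iter_shift1.
rewrite spike_orth0 ?iter_shift0 //; lia.
Qed.

(** On monomials of gauge degree [d] built from words of length at most [L] this map
is multiplication by [1 - |d| / L], as for the Fejer kernel of order [L] of the
gauge action, and it is an average of compressions by isometries of the algebra,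
hence a contraction. The shifts start at [L] so that they pass the
monomials, and the spike has length above [2 L] so that all the shifts involved
are orthogonal. The parameter [M] does not change the value on these
monomials. *)
Definition fejer L M x : A :=
  row_avg (fun (i : 'I_L) c => iter (L + i) shift (S c))
          (fun i => iter (L + i) shift (W (spike (L + L)))) M x.

Lemma nrm_fejer L M x : nrm (fejer L M x) <= nrm x.
Proof.
apply: nrm_row_avg => [|i c|i j]; first exact: ltnW.
- exact: iter_shift_isometry.
- rewrite spike_orth ?eqn_add2l //; have := ltn_ord i; have := ltn_ord j; lia.
Qed.

Lemma fejer_term L M mu nu (i j : 'I_L) : (size mu <= L)%N -> (size nu <= L)%N ->
  let v := W mu * star (W nu) in
  iter M (avg (fun c => iter (L + i) shift (S c)) (fun c => iter (L + j) shift (S c)))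
    (star (iter (L + i) shift (W (spike (L + L)))) * v *
     iter (L + j) shift (W (spike (L + L)))) =
  ((i + size nu == j + size mu)%N)%:R *: v.
Proof.
move=> hmu hnu v; have hi := ltn_ord i; have hj := ltn_ord j.
have hv x : v * iter (L + j) shift x =
    iter (size mu + (L + j - size nu)) shift x * v.
  by rewrite -sandwich_iter_shift // subnKC //; lia.
rewrite -mulrA hv mulrA spike_orth; [|lia|lia].
have -> : (L + i == size mu + (L + j - size nu))%N = (i + size nu == j + size mu)%N.
  by apply/eqP/eqP; lia.
case: eqP => [e|_]; last by rewrite mul0r scale0r iter_avg0.
rewrite mul1r scale1r; elim: M => //= M ->; rewrite /avg.
have e' : (size mu + (L + j - size nu) = L + i)%N by lia.
rewrite (eq_bigr (fun=> v)) => [|c _]; last first.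
  rewrite -mulrA hv e' mulrA (_ : star _ * _ = 1) ?mul1r //.
  exact: iter_shift_isometry.
rewrite sumr_const card_ord -[v *+ n]scaler_nat scalerA mulVf ?scale1r //.
by rewrite pnatr_eq0 -lt0n ltnW.
Qed.

Lemma sum_lt_bound L b : (\sum_(i < L) (i < b) <= b)%N.
Proof.
elim: L => [|L IH]; first by rewrite big_ord0.
have [bL|Lb] := leqP b L; first by rewrite big_ord_recr /= ltnNge bL addn0.
apply: leq_trans Lb; rewrite -[X in (_ <= X)%N]card_ord -sum1_card.
by apply: leq_sum => i _; case: (_ < _)%N.
Qed.

(** A row [i] misses its entry on the shifted diagonal only if [i < a] or
[L <= i + b]. *)
Lemma diagonal_count L a b :
  (\sum_(i < L) \sum_(j < L) (i + b == j + a) <= L <=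
   \sum_(i < L) \sum_(j < L) (i + b == j + a) + (a + b))%N.
Proof.
apply/andP; split.
  rewrite -[X in (_ <= X)%N](card_ord L) -sum1_card; apply: leq_sum => i _.
  have [[j0 /eqP h0]|h] := pselect (exists j : 'I_L, (i + b == j + a)%N).
    rewrite (bigD1 j0) //= big1 ?addn0 ?leq_b1 // => j /eqP jj0.
    by case: eqP => // h1; case: jj0; apply: val_inj => /=; lia.
  by rewrite big1 // => j _; case: eqP => // /eqP hj; case: h; exists j.
have h1 := sum_lt_bound L a.
have h2 : (\sum_(i < L) (L <= i + b) <= b)%N.
  apply: leq_trans (sum_lt_bound L b); rewrite (reindex_inj rev_ord_inj) /=.
  apply: leq_sum => i _; have := ltn_ord i; lia.
apply: (@leq_trans (\sum_(i < L) (\sum_(j < L) (i + b == j + a) +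
   ((i < a) + (L <= i + b))))%N); last by rewrite !big_split /= leq_add2l leq_add.
rewrite -[X in (X <= _)%N](card_ord L) -sum1_card; apply: leq_sum => i _.
have [ia|ia] := ltnP i a; first lia.
have [ib|ib] := leqP L (i + b); first lia.
have jL : (i + b - a < L)%N by lia.
by rewrite (bigD1 (Ordinal jL)) //= subnK ?eqxx //; lia.
Qed.

Lemma fejer_words L M mu nu : (0 < L)%N -> (size mu <= L)%N -> (size nu <= L)%N ->
  nrm (fejer L M (W mu * star (W nu)) - W mu * star (W nu)) <=
  (size mu + size nu)%:R / L%:R.
Proof.
move=> L0 hmu hnu; set v := W mu * _.
set C := (\sum_(i < L) \sum_(j < L) (i + size nu == j + size mu))%N.
have -> : fejer L M v = (L%:R^-1 * C%:R : R[i]) *: v.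
  rewrite /fejer /row_avg -scalerA; congr (_ *: _).
  rewrite natr_sum scaler_suml; apply: eq_bigr => i _.
  rewrite natr_sum scaler_suml; apply: eq_bigr => j _.
  exact: fejer_term.
have /andP[CL LC] := diagonal_count L (size mu) (size nu).
rewrite -/C in CL LC.
have LC0 : (L%:R : R[i]) != 0 by rewrite pnatr_eq0 -lt0n.
have -> : (L%:R^-1 * C%:R : R[i]) *: v - v = - ((L%:R^-1 * (L - C)%:R) *: v).
  by rewrite -[X in _ - X]scale1r -scalerBl -scaleNr natrB // mulrBr mulVf // opprB.
have hv : nrm v <= 1.
  have := nrmM (W mu) (star (W nu)).
  by rewrite nrm_star !(nrm_isometry (word_isometry hS _)) mulr1.
rewrite nrmN nrmZ.
have -> : nrm (L%:R^-1 * (L - C)%:R : R[i]) = (L - C)%:R / L%:R.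
  rewrite -[L%:R](rmorph_nat (real_complex R)).
  rewrite -(rmorph_nat (real_complex R) (L - C)) -fmorphV -rmorphM.
  by rewrite nrmC_real ger0_norm mulrC // mulr_ge0 ?invr_ge0 ?ler0n.
apply: (@le_trans _ _ ((L - C)%:R / L%:R)).
  by rewrite ler_piMr // mulr_ge0 ?invr_ge0 ?ler0n.
by rewrite ler_wpM2r ?invr_ge0 ?ler0n // ler_nat leq_subLR.
Qed.

(** Contractivity of [fejer] reduces the convergence to monomials, where the error
is at most [(|mu| + |nu|) / L]; the bound is uniform in [M]. *)
Lemma fejer_cvg x (e : R) : 0 < e -> exists L0, forall L M, (L0 <= L)%N ->
  nrm (fejer L M x - x) <= e.
Proof.
move: x e; apply: (dense_ind hS).
  split=> [x y hx hy e e0|a x hx e e0|x hx e e0].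
  - have e2 : 0 < e / 2 by lra.
    have [K hK] := hx _ e2; have [K' hK'] := hy _ e2.
    exists (maxn K K') => L M; rewrite geq_max => /andP[/(hK _ M) h1 /(hK' _ M) h2].
    rewrite /fejer row_avgD opprD addrACA; apply: le_trans (nrm_leD _ _) _.
    move: h1 h2; rewrite /fejer; lra.
  - have a1 : 0 < nrm a + 1 by rewrite ltr_wpDl ?nrm_ge0.
    have [|K hK] := hx (e / (nrm a + 1)); first exact: divr_gt0.
    exists K => L M /(hK _ M); rewrite /fejer row_avgZ -scalerBr nrmZ ler_pdivlMr //.
    have := nrm_ge0 (fejer L M x - x); rewrite /fejer; nra.
  - have e3 : 0 < e / 3 by lra.
    have [y hy xy] := hx _ e3; have [K hK] := hy _ e3.
    exists K => L M /(hK _ M) h1.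
    have h2 : nrm (fejer L M x - fejer L M y) <= nrm (x - y).
      by rewrite -row_avgB; exact: nrm_fejer.
    have := nrm_tri (fejer L M y) (fejer L M x) x.
    have := nrm_tri y (fejer L M y) x.
    rewrite (nrmB y x); lra.
move=> mu nu e e0; set d := (size mu + size nu)%N.
exists (Num.bound (d%:R / e) + d.+1)%N => L M hL.
apply: le_trans (fejer_words _ _ _ _) _; [lia|lia|lia|].
have L0 : (0 : R) < L%:R by rewrite ltr0n; lia.
rewrite ler_pdivrMr // mulrC -ler_pdivrMr // -/d.
apply: le_trans (ltW (archi_boundP _)) _; first by rewrite divr_ge0 ?ler0n ?ltW.
by rewrite ler_nat (leq_trans _ hL) ?leq_addr.
Qed.

Variable phi : A -> R[i].
Hypothesis phiP : forall x, state_at S x (phi x).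

(** As [M] grows the matrix entries of the Fejer mean converge to the scalars
[phi ((x S_mu')^* (x S_nu'))], with [mu'] and [nu'] the words extended by the
spike, and these are 0 by [phi_null]. *)
Lemma fejer_vanishing L x : complex.Re (phi (star x * x)) = 0 ->
  vanishing (fun M => nrm (fejer L M (star x * x))).
Proof.
move=> hx.
pose F (i j : 'I_L) M := nrm (iter M
  (avg (fun c => iter (L + i) shift (S c)) (fun c => iter (L + j) shift (S c)))
  (star (iter (L + i) shift (W (spike (L + L)))) * (star x * x) *
   iter (L + j) shift (W (spike (L + L))))).
have hF i j : vanishing (F i j).
  apply: vanishing_avg => // mu nu hmu hnu.
  have hs rho (k : 'I_L) : size rho = (L + k)%N ->
      iter (L + k) shift (W (spike (L + L))) * W rho = W (rho ++ spike (L + L)).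
    move=> hk; have := iter_shift_word hS rho 0 (W (spike (L + L))).
    by rewrite addn0 hk /= word_cat.
  set y := _ * W nu.
  have hy : y = star (x * W (mu ++ spike (L + L))) * (x * W (nu ++ spike (L + L))).
    by rewrite /y -(hs _ _ hmu) -(hs _ _ hnu) !starM !mulrA.
  have y0 : phi y = 0 by rewrite hy; apply: (phi_null hS hn) => //; exact: phi_null_word.
  move=> e e0; have [M0 hM] := phiP y e0; exists M0 => M /hM.
  by rewrite y0 scale0r subr0.
have hG : vanishing (fun M => \sum_i \sum_j F i j M).
  apply: (@vanishing_sum _ _ _ (fun i M => \sum_j F i j M)) => i.
  exact: (@vanishing_sum _ _ _ (F i)).
apply: vanishing_le hG => M; rewrite nrmZ nrmC_natV.
have hL : (L%:R^-1 : R) <= 1.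
  by case: (L) => [|k]; rewrite ?invr0 ?ler01 // invf_le1 ?ltr0n // ler1n.
apply: le_trans (ler_piMl (nrm_ge0 _) hL) _.
apply: le_trans (nrm_sum _ _) _; apply: ler_sum => i _; exact: nrm_sum.
Qed.

(** First [L] is chosen for the convergence of the Fejer means, uniformly in [M],
and then [M] for their decay. *)
Lemma phi_faithful x : complex.Re (phi (star x * x)) = 0 -> x = 0.
Proof.
move=> hx; apply: nrm0_eq; apply/eqP; rewrite -sqrf_eq0 -nrm_starM.
rewrite (_ : star x * x = 0) ?nrm0 //; apply: nrm_eq0 => e e0.
have e2 : 0 < e / 2 by lra.
have [L hL] := fejer_cvg (star x * x) e2.
have [M hM] := fejer_vanishing L hx e2.
have := hL L M (leqnn _); have := hM M (leqnn _).
have := nrm_tri (fejer L M (star x * x)) (star x * x) 0.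
rewrite !subr0 (nrmB (star x * x)); lra.
Qed.

End Faithful.

(** * The core and the main theorem *)
Section Core.
Context {R : realType} {A : cstarAlgebra R} {n : nat} (S : 'I_n -> A).
Hypothesis hS : is_cuntz_algebra S.
Hypothesis hn : (2 <= n)%N.

Let S_sum : \sum_(i < n) S i * star (S i) = 1. Proof. by case: hS. Qed.
Local Notation W := (word_op S).

Variable phi : A -> R[i].
Hypothesis phiP : forall x, state_at S x (phi x).

(** For [|mu| = |nu|] the two factors in [phi_shift] and [phi_shift_star] cancel. *)
Lemma phi_core_comm f x : core_UHF S f -> phi (f * x) = phi (x * f).
Proof.
move=> /closure_approx hf; apply/eqP; rewrite -subr_eq0; apply/eqP/nrm_eq0 => e e0.
have k0 : 0 < 2 * nrm x + 1 by have := nrm_ge0 x; lra.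
have [|y [k _ [c ->]]] := hf (e / (2 * nrm x + 1)); first exact: divr_gt0.
set y0 := \sum_mu _; rewrite ltr_pdivlMr // => fy.
have hy : phi (y0 * x) = phi (x * y0).
  rewrite mulr_suml mulr_sumr !(phi_sum hS) //; apply: eq_bigr => mu _.
  rewrite mulr_suml mulr_sumr !(phi_sum hS) //; apply: eq_bigr => nu _.
  rewrite -scalerAl -scalerAr !(phiZ hS) //; congr (_ * _).
  by rewrite -mulrA (phi_shift hS) // mulrA (phi_shift_star hS) // -mulrA
    !size_tuple mulrA.
have -> : phi (f * x) - phi (x * f) = phi ((f - y0) * x - x * (f - y0)).
  rewrite mulrBl mulrBr !(phiB hS phiP) hy.
  by rewrite opprB addrA subrK.
apply: le_trans (phi_le hS phiP _) _; apply: le_trans (nrm_leD _ _) _.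
have := nrmM (f - y0) x; have := nrmM x (f - y0); rewrite nrmN.
by have := nrm_ge0 (f - y0); have := nrm_ge0 x; nra.
Qed.

Lemma word_pair_core mu nu : size mu = size nu ->
  core_UHF S (W mu * star (W nu)).
Proof.
move=> hs; apply: subset_closure; exists (size mu) => //.
pose tm := in_tuple mu; pose tn : (size mu).-tuple 'I_n := Tuple (introT eqP (esym hs)).
exists (fun a b => ((a == tm) && (b == tn))%:R).
rewrite (bigD1 tm) //= [X in _ + X]big1 ?addr0 => [|a /negbTE ha]; last first.
  by rewrite big1 // => b _; rewrite ha scale0r.
rewrite (bigD1 tn) //= big1 ?addr0 => [|b /negbTE hb]; last first.
  by rewrite hb andbF scale0r.
by rewrite !eqxx scale1r.
Qed.

(** The projections [alpha P_(mu j)] for the [n] letters [j] have sum [alpha P_mu].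
They are [u u^*] and [u^* u] for elements [u] of the core, so [phi] gives them
the same value. *)
Lemma phi_endo_word_proj (alpha : {lrmorphism A -> A}) mu :
  (forall x, alpha (star x) = star (alpha x)) ->
  alpha @` core_UHF S `<=` core_UHF S ->
  phi (alpha (word_proj S mu)) = n%:R^-1 ^+ size mu.
Proof.
move=> alpha_star alpha_core; elim/last_ind: mu => [|mu i IH].
  by rewrite /word_proj word_nil star1 mulr1 rmorph1 (phi1 hS).
have hP j : phi (alpha (word_proj S (rcons mu j))) =
            phi (alpha (word_proj S (rcons mu i))).
  set u := W (rcons mu j) * star (W (rcons mu i)).
  have hu : core_UHF S (alpha u).
    by apply: alpha_core; exists u => //; apply: word_pair_core; rewrite !size_rcons.
  have e1 : word_proj S (rcons mu j) = u * star u.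
    rewrite /word_proj /u starM starK mulrA -(mulrA (W (rcons mu j))).
    by rewrite word_isometry // mulr1.
  have e2 : word_proj S (rcons mu i) = star u * u.
    rewrite /word_proj /u starM starK mulrA -(mulrA (W (rcons mu i))).
    by rewrite word_isometry // mulr1.
  by clearbody u; rewrite e1 e2 !rmorphM; exact: phi_core_comm.
have hsum : word_proj S mu = \sum_j word_proj S (rcons mu j).
  rewrite /word_proj -[X in X * _]mulr1 -S_sum mulr_sumr mulr_suml.
  apply: eq_bigr => j _; rewrite -cats1 word_cat word_cons word_nil mulr1.
  by rewrite starM !mulrA.
move: IH; rewrite hsum rmorph_sum (phi_sum hS) // (eq_bigr _ (fun j _ => hP j)).
rewrite sumr_const card_ord size_rcons exprS => <-.
by rewrite -[phi _ *+ n]mulr_natl mulrA mulVf ?mul1r // pnatr_eq0 -lt0n ltnW.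
Qed.

(** Positivity gives [phi p <= phi (a k)], which tends to 0, and [p = p^* p]. *)
Lemma projection_null (p : A) (a : nat -> A) (m : nat -> nat) : projection p ->
  (forall k, (k < m k)%N) -> (forall k, cstar_le p (a k)) ->
  (forall k, phi (a k) = n%:R^-1 ^+ m k) -> p = 0.
Proof.
move=> [pp sp] hm hle ha; apply: (phi_faithful hS hn phiP).
rewrite sp pp; apply/eqP; rewrite eq_le; apply/andP; split; last first.
  by rewrite -[p in phi p]pp -{1}sp; exact: (phi_ge0 hS hn phiP).
apply/ler_addgt0Pr => e e0; rewrite add0r.
have [M0 hM] := pow_small hn e0.
have [x hx] := hle M0; have := phi_ge0 hS hn phiP x.
rewrite -hx (phiB hS phiP) ha raddfB /=.
rewrite -(rmorph_nat (real_complex R)) -fmorphV -rmorphXn /=.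
have := hM (m M0) (ltnW (hm M0)); lra.
Qed.

End Core.

Lemma size_flatten_mkseq (T : Type) (nu : nat -> seq T) k :
  (forall k, nu k <> [::]) -> (k < size (flatten (mkseq nu k.+1)))%N.
Proof.
move=> nu0; elim: k => [|k IH].
  by rewrite /mkseq /= cats0; case: (nu 0%N) (nu0 0%N).
rewrite mkseqS -cats1 flatten_cat size_cat /= cats0.
by case: (nu k.+1) (nu0 k.+1) => [|i s] // _; rewrite /= addnS ltnS ltn_addr.
Qed.

Theorem proposition3p3 (R : realType) (n : nat) (hn : (2 <= n)%N)
    (A : cstarAlgebra R) (S : 'I_n -> A) (hS : is_cuntz_algebra S)
    (alpha : {lrmorphism A -> A})
    (alpha_star : forall x : A, alpha (star x) = star (alpha x)) :
  bijective alpha \/ alpha @` core_UHF S `<=` core_UHF S ->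
  modestly_scaling S alpha.
Proof.
move=> hyp nu nu0 p hp ple.
have /choice[phi phiP] := state_at_exists hS hn.
case: hyp => [[g gK Kg]|core_stable]; last first.
  apply: (projection_null hS hn phiP hp _ ple) => [k|k].
    exact: size_flatten_mkseq.
  exact: phi_endo_word_proj.
(* The preimage of [p] is a projection dominated by the [P_mu] themselves. *)
have inj := can_inj gK.
have aM x y : alpha (x * y) = alpha x * alpha y by exact: rmorphM.
have aB x y : alpha (x - y) = alpha x - alpha y by exact: rmorphB.
suff gp0 : g p = 0 by rewrite -(Kg p) gp0 rmorph0.
case: hp => pp sp.
apply: (projection_null hS hn phiP (a := fun k => word_proj S (flatten (mkseq nu k.+1)))
  (m := fun k => size (flatten (mkseq nu k.+1)))) => [|k|k|k].
- by split; apply: inj; rewrite ?aM ?alpha_star !Kg.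
- exact: size_flatten_mkseq.
- have [x hx] := ple k; exists (g x); apply: inj.
  by rewrite aB (aM (star _)) alpha_star !Kg; exact: hx.
- by rewrite /word_proj (phi_shift hS phiP) word_isometry // (phi1 hS) // mulr1.
Qed.
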